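(* Let $d,\ell,k$ be positive integers with $k\le\ell$, let $\Omega\colon S^{d-1}\to G(\ell,k)$ be Hölder continuous, and let $B(\zeta)$, $\zeta\in S^{d-1}$, be a Hölder continuous family of linear functionals $B(\zeta)\colon\Omega(\zeta)\to\mathbb{C}$. Suppose that $B$ is weakly canceling, that is, $$\forall v\in V\qquad \int_{S^{d-1}}B(\zeta)[v]\,d\sigma(\zeta)=0,\qquad\text{where } V=\bigcap_{\zeta\in S^{d-1}}\Omega(\zeta).$$ Then the operator $\mathbb{B}$ formally given by $$\mathbb{B}[g]=\mathcal{F}^{-1}\Big[|\xi|^{-d}B\Big(\frac{\xi}{|\xi|}\Big)\big[\hat g(\xi)\big]\Big],\qquad g\in W_1^\Omega,$$ maps $W_1^\Omega$ to $L_\infty$ continuously, in the following sense: there is a constant $C$ such that for all $0<\varepsilon<R$ and all $g\in W_1^\Omega$, $$\Big\|\mathcal{F}^{-1}\Big[\chi_{\{\varepsilon\le|\xi|\le R\}}\,|\xi|^{-d}B\Big(\frac{\xi}{|\xi|}\Big)\big[\hat g(\xi)\big]\Big]\Big\|_{L_\infty(\mathbb{R}^d)}\le C\|g\|_{L_1(\mathbb{R}^d,\mathbb{C}^\ell)}.$$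
   Context: $S^{d-1}$ is the unit sphere in $\mathbb{R}^d$ and $\sigma$ is the Lebesgue (surface) measure on it. $G(\ell,k)$ is the complex Grassmannian of all $k$-dimensional linear subspaces of $\mathbb{C}^\ell$, with the metric $\mathrm{dist}(L_1,L_2)=\|\pi_{L_1}-\pi_{L_2}\|_{\mathrm{HS}}$, where $\pi_L$ is the orthogonal projection of $\mathbb{C}^\ell$ onto $L$ and $\|\cdot\|_{\mathrm{HS}}$ is the Hilbert--Schmidt norm on $\ell\times\ell$ complex matrices. A map $F\colon M\to N$ between metric spaces is called Hölder continuous if there are $\alpha>0$ and $C$ such that $\mathrm{dist}_N(F(x),F(y))\le C\,\mathrm{dist}_M(x,y)^\alpha$ for all $x,y\in M$ with $\mathrm{dist}_M(x,y)\le 1$. The family $B$ is regarded as a function $(\zeta,v)\mapsto B(\zeta)[v]$ on $\omega=\{(\zeta,v)\mid \zeta\in S^{d-1},\ v\in\Omega(\zeta)\}\subset S^{d-1}\times\mathbb{C}^\ell$, linear in $v$; ''Hölder continuous'' means that the restriction of this function to $\{(\zeta,v)\in\omega\mid |v|\le1\}$ is Hölder continuous (equivalently, the linear functional $B(\zeta)\circ\pi_{\Omega(\zeta)}$ on $\mathbb{C}^\ell$ depends on $\zeta$ in a Hölder continuous way). The space $W_1^\Omega$ is $$W_1^\Omega=\Big\{g\in L_1(\mathbb{R}^d,\mathbb{C}^\ell)\ \Big|\ \hat g(\xi)\in\Omega\big(\xi/|\xi|\big)\ \text{ for all }\xi\in\mathbb{R}^d\setminus\{0\}\Big\},$$ with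 the norm inherited from $L_1(\mathbb{R}^d,\mathbb{C}^\ell)$. $\hat g$ and $\mathcal{F}^{-1}$ denote the Fourier transform (coordinatewise) and the inverse Fourier transform, with any fixed normalization; $\chi$ denotes an indicator function. *)

(* Defs.v *)
From HB Require Import structures.
From mathcomp Require Import all_boot all_order all_algebra.
From mathcomp Require Import spectral.
From mathcomp Require Import complex.
From mathcomp Require Import all_classical all_reals all_analysis.
From mathcomp Require Import measurable_realfun ess_sup_inf.

Set Implicit Arguments.
Unset Strict Implicit.
Unset Printing Implicit Defensive.

Import Order.TTheory GRing.Theory Num.Theory.
Import numFieldNormedType.Exports.

Local Open Scope classical_set_scope.
Local Open Scope ring_scope.
Local Open Scope complex_scope.

(* R^n is 'rV[R]_n and C^n is 'rV[R[i]]_n.  The library's norm on matrices is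
   the sup norm, so the Euclidean norm is defined here. *)

Section norms.
Variable R : realType.

Definition dotr (n : nat) (x y : 'rV[R]_n) : R := \sum_i x 0 i * y 0 i.

Definition enorm (n : nat) (x : 'rV[R]_n) : R := Num.sqrt (dotr x x).

(* The Hilbert-Schmidt norm; on row vectors it is the Euclidean norm of C^n. *)
Definition hsnorm (m n : nat) (A : 'M[R[i]]_(m, n)) : R :=
  Num.sqrt (\sum_i \sum_j Normc.normc (A i j) ^+ 2).

Definition sphere (d : nat) : set 'rV[R]_d := [set x | enorm x = 1].

Definition direction (d : nat) (x : 'rV[R]_d) : 'rV[R]_d := (enorm x)^-1 *: x.

End norms.
Arguments sphere {R} d.

(* The Borel sigma-algebra of R^n, generated by the coordinates. *)

Definition measure_rV_display : measure_display -> measure_display.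
Proof. exact. Qed.

Section measurable_rV.
Context {d} {T : measurableType d} (n : nat).

Let coor (i : 'I_n) (x : 'rV[T]_n) : T := x 0 i.

Let rV_set0 : g_sigma_preimage coor set0.
Proof. exact: sigma_algebra0. Qed.

Let rV_setC A : g_sigma_preimage coor A -> g_sigma_preimage coor (~` A).
Proof. exact: sigma_algebraC. Qed.

Let rV_bigcup (F : (set 'rV[T]_n)^nat) :
  (forall i, g_sigma_preimage coor (F i)) ->
  g_sigma_preimage coor (\bigcup_i (F i)).
Proof. exact: sigma_algebra_bigcup. Qed.

HB.instance Definition _ := @isMeasurable.Build (measure_rV_display d)
  'rV[T]_n (g_sigma_preimage coor) rV_set0 rV_setC rV_bigcup.

End measurable_rV.

(* Lebesgue measure on R^n, as the n-fold product of Lebesgue measure on R. *)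

Section lebesgue_rV.
Variable R : realType.

Definition consrV (n : nat) (p : R * 'rV[R]_n) : 'rV[R]_n.+1 :=
  row_mx (p.1)%:M p.2.

Lemma consrV0 n (p : R * 'rV[R]_n) : consrV p 0 ord0 = p.1.
Proof.
rewrite -[LHS]/(row_mx (p.1)%:M p.2 0 ord0).
have -> : ord0 = lshift n (0 : 'I_1) :> 'I_(1 + n) by exact/val_inj.
by rewrite (row_mxEl (p.1)%:M) mxE eqxx.
Qed.

Lemma consrVS n (p : R * 'rV[R]_n) (i : 'I_n) :
  consrV p 0 (lift ord0 i) = p.2 0 i.
Proof.
rewrite -[LHS]/(row_mx (p.1)%:M p.2 0 (lift ord0 i)).
have -> : lift ord0 i = rshift 1 i :> 'I_(1 + n) by exact/val_inj.
by rewrite (row_mxEr (p.1)%:M).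
Qed.

Lemma measurable_coord (n : nat) (i : 'I_n) :
  measurable_fun [set: 'rV[R]_n] (fun x : 'rV[R]_n => x 0 i).
Proof.
move=> _ Y mY; rewrite setTI; apply: sub_sigma_algebra => /=.
rewrite -bigcup_seq/=; exists i => /=; first by rewrite mem_index_enum.
by exists Y => //; rewrite setTI.
Qed.

Lemma measurable_fun_rV d (T : measurableType d) (n : nat)
    (f : T -> 'rV[R]_n) :
  (forall i, measurable_fun [set: T] (fun t => f t 0 i)) ->
  measurable_fun [set: T] f.
Proof.
move=> mf; suff H : measurable `<=` [set A | measurable (f @^-1` A)].
  by move=> _ A /H /=; rewrite setTI.
apply: smallest_sub.
  split => /= [|A mA|F mF].
  - by rewrite preimage_set0.
  - by rewrite setTD preimage_setC; exact: measurableC.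
  - by rewrite preimage_bigcup; exact: bigcup_measurable.
move=> A; rewrite -bigcup_seq/= => -[i _ [B mB <-]] /=.
by rewrite setTI -[X in measurable X]setTI; exact: mf.
Qed.

Lemma measurable_consrV (n : nat) :
  measurable_fun [set: R * 'rV[R]_n] (@consrV n).
Proof.
apply: measurable_fun_rV => i; have [j ->|->] := unliftP ord0 i.
- under eq_fun do rewrite consrVS.
  exact: (measurableT_comp (measurable_coord j)).
- by under eq_fun do rewrite consrV0; exact: measurable_fst.
Qed.

Section step.
Variables (n : nat) (mu : {sigma_finite_measure set 'rV[R]_n -> \bar R}).

Definition lebesgue_step : set 'rV[R]_n.+1 -> \bar R :=
  pushforward (@lebesgue_measure R \x mu)%E (@consrV n).

HB.instance Definition _ := Measure.copy lebesgue_step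
  (measure_function_pushforward__canonical__measure_function_Measure
    (@lebesgue_measure R \x mu)%E (@measurable_consrV n)).

Let lebesgue_step_sigma_finite : sigma_finite setT lebesgue_step.
Proof.
have /sigma_finiteP[F [TF ndF mF]] := sigma_finiteT (@lebesgue_measure R).
have /sigma_finiteP[G [TG ndG mG]] := sigma_finiteT mu.
pose u (x : 'rV[R]_n.+1) : R * 'rV[R]_n := (x 0 ord0, \row_i x 0 (lift ord0 i)).
have uK : cancel (@consrV n) u.
  case=> a v; congr pair; first exact: consrV0.
  by apply/rowP => i; rewrite mxE consrVS.
have mu_ : measurable_fun [set: 'rV[R]_n.+1] u.
  apply/measurable_fun_pairP; split; first exact: measurable_coord.
  apply: measurable_fun_rV => i; rewrite /comp /=.
  under eq_fun do rewrite mxE.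
  exact: measurable_coord.
have uE A : @consrV n @^-1` (u @^-1` A) = A.
  by rewrite -comp_preimage; apply/seteqP; split=> x /=; rewrite uK.
exists (fun k => u @^-1` (F k `*` G k)) => [|k].
  apply/esym; rewrite -preimage_bigcup -subTset => x _.
  have [i _ Fi] : (\bigcup_k F k) (u x).1 by rewrite -TF.
  have [j _ Gj] : (\bigcup_k G k) (u x).2 by rewrite -TG.
  exists (maxn i j) => //; split.
  - by move: Fi; exact/subsetPset/ndF/leq_maxl.
  - by move: Gj; exact/subsetPset/ndG/leq_maxr.
have [mFk Fkoo] := mF k; have [mGk Gkoo] := mG k; split.
  by rewrite -[X in measurable X]setTI; apply: mu_ => //; exact: measurableX.
rewrite /lebesgue_step /pushforward uE product_measure1E//.
by rewrite lte_mul_pinfty// ge0_fin_numE.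
Qed.

HB.instance Definition _ := Measure_isSigmaFinite.Build _ _ _ lebesgue_step
  lebesgue_step_sigma_finite.

End step.

Fixpoint lebesgue_rV (n : nat) : {sigma_finite_measure set 'rV[R]_n -> \bar R} :=
  match n with
  | 0%N => \d_(0 : 'rV[R]_0)
  | m.+1 => lebesgue_step (lebesgue_rV m)
  end.

End lebesgue_rV.

(* The surface measure of the unit sphere, in polar coordinates:
   sigma(A) = d * |{x | 0 < |x| <= 1, x / |x| \in A}|.  It is a measure on R^d
   carried by the sphere; for d = 1 it is the counting measure of {-1, 1}. *)

Section surface_measure.
Variable R : realType.

Lemma measurable_dotr d (T : measurableType d) (n : nat) (f g : T -> 'rV[R]_n) :
  measurable_fun setT f -> measurable_fun setT g ->
  measurable_fun setT (fun x => dotr (f x) (g x)).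
Proof.
move=> mf mg; apply: measurable_sum => i; apply: measurable_funM.
- exact: (measurableT_comp (measurable_coord i)).
- exact: (measurableT_comp (measurable_coord i)).
Qed.

Lemma measurable_enorm (n : nat) : measurable_fun setT (@enorm R n).
Proof.
have msqrt : measurable_fun setT (@Num.sqrt R).
  by apply: continuous_measurable_fun; exact: sqrt_continuous.
apply: (measurableT_comp msqrt).
by apply: measurable_dotr; exact: measurable_id.
Qed.

Lemma measurable_direction (n : nat) : measurable_fun setT (@direction R n).
Proof.
apply: measurable_fun_rV => i; under eq_fun do rewrite mxE.
apply: measurable_funM; last exact: measurable_coord.
have -> : (fun x : 'rV[R]_n => (enorm x)^-1) = (@powR R ^~ (-1)) \o @enorm R n.
  by apply/funext => x; rewrite /= powR_inv1// sqrtr_ge0.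
by apply: measurableT_comp => //; exact: measurable_enorm.
Qed.

Definition punctured_ball (n : nat) : set 'rV[R]_n :=
  [set x | 0 < enorm x <= 1].
Arguments punctured_ball n : clear implicits.

Lemma measurable_punctured_ball (n : nat) :
  measurable (punctured_ball n).
Proof.
have -> : punctured_ball n = @enorm R n @^-1` `]0, 1]%classic.
  by apply/seteqP; split=> x /=; rewrite in_itv.
by rewrite -[X in measurable X]setTI; exact: measurable_enorm.
Qed.

Definition surface_measure (n : nat) : set 'rV[R]_n -> \bar R := fun A =>
  (n%:R%:E *
   lebesgue_rV R n (@direction R n @^-1` A `&` punctured_ball n))%E.

HB.instance Definition _ (n : nat) := Measure.copy (@surface_measure n)
  (mscale n%:R%:nng
    (measure_function_pushforward__canonical__measure_function_Measure
      (mrestr (lebesgue_rV R n) (@measurable_punctured_ball n))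
      (@measurable_direction n))).

End surface_measure.
Arguments surface_measure R n : clear implicits.

Section complex_integral.
Context d (T : measurableType d) (R : realType).
Variables (mu : {measure set T -> \bar R}) (D : set T).

Definition cintegrable (f : T -> R[i]) : Prop :=
  mu.-integrable D (EFin \o (@complex.Re R \o f)) /\
  mu.-integrable D (EFin \o (@complex.Im R \o f)).

(* The library's integral of a non-integrable real function is a junk value. *)
Definition cintegral (f : T -> R[i]) : R[i] :=
  (\int[mu]_(x in D) complex.Re (f x)) +i* (\int[mu]_(x in D) complex.Im (f x)).

End complex_integral.

(* The Fourier transform with the normalization exp (- 2 pi i <x, xi>). *)

Section fourier.
Context (R : realType) (d : nat).

Definition cis (t : R) : R[i] := cos t +i* sin t.

Definition fourier (l : nat) (g : 'rV[R]_d -> 'rV[R[i]]_l) (xi : 'rV[R]_d) :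
    'rV[R[i]]_l :=
  \row_j cintegral (lebesgue_rV R d) setT
    (fun x => cis (- (2 * pi * dotr x xi)) * g x 0 j).

Definition inverse_fourier (h : 'rV[R]_d -> R[i]) (x : 'rV[R]_d) : R[i] :=
  cintegral (lebesgue_rV R d) setT
    (fun xi => cis (2 * pi * dotr x xi) * h xi).

End fourier.

Definition holder (R : realType) (M N : Type)
    (distM : M -> M -> R) (distN : N -> N -> R) (A : set M) (F : M -> N) : Prop :=
  exists alpha C : R, 0 < alpha /\
    forall x y, A x -> A y -> distM x y <= 1 ->
      distN (F x) (F y) <= C * distM x y `^ alpha.

Section grassmannian.
Context (R : realType) (l : nat).
Implicit Types L : {vspace 'rV[R[i]]_l}.

Definition grassmannian (k : nat) : set {vspace 'rV[R[i]]_l} :=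
  [set L | \dim L = k].

(* The orthogonal projection onto L, acting on row vectors by v *m orthproj L. *)
Definition orthproj L : 'M[R[i]]_l :=
  proj_ortho (\matrix_(i < \dim L) tnth (vbasis L) i).

Definition dist_grass L1 L2 : R := hsnorm (orthproj L1 - orthproj L2).

End grassmannian.
Arguments grassmannian {R} l k.

Section operator.
Context (R : realType) (d l : nat).
Variable Omega : 'rV[R]_d -> {vspace 'rV[R[i]]_l}.

(* The families Omega and B are indexed by all of R^d, but every condition on
   them concerns unit vectors only; their values elsewhere are immaterial. *)
Definition holder_subspaces : Prop :=
  holder (fun x y : 'rV[R]_d => enorm (x - y)) (@dist_grass R l)
    (sphere d) Omega.

Definition W1 : set ('rV[R]_d -> 'rV[R[i]]_l) :=
  [set g : 'rV[R]_d -> 'rV[R[i]]_l |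
    (forall j, cintegrable (lebesgue_rV R d) setT (fun x => g x 0 j)) /\
    (forall xi, xi != 0 -> fourier g xi \in Omega (direction xi))].

Variable B : forall z : 'rV[R]_d, {linear subvs_of (Omega z) -> R[i]}.

(* B z v for v in Omega z: vsproj only casts such a v to the type of elements
   of Omega z, and is not applied to other vectors, except at frequency 0, where
   the cutoff in truncated_operator vanishes. *)
Definition fun_of_family (z : 'rV[R]_d) (v : 'rV[R[i]]_l) : R[i] :=
  B z (vsproj (Omega z) v).

Definition holder_family : Prop :=
  holder
    (fun p q : 'rV[R]_d * 'rV[R[i]]_l =>
       Num.sqrt (enorm (p.1 - q.1) ^+ 2 + hsnorm (p.2 - q.2) ^+ 2))
    (fun a b : R[i] => Normc.normc (a - b))
    [set p | [/\ sphere d p.1, p.2 \in Omega p.1 & hsnorm p.2 <= 1]]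
    (fun p => fun_of_family p.1 p.2).

Definition weakly_canceling : Prop :=
  forall v : 'rV[R[i]]_l,
    (\bigcap_(z in sphere d) [set` Omega z]) v ->
    cintegral (surface_measure R d) (sphere d) (fun z => fun_of_family z v) = 0.

Definition truncated_operator (eps rho : R) (g : 'rV[R]_d -> 'rV[R[i]]_l) :
    'rV[R]_d -> R[i] :=
  inverse_fourier (fun xi =>
    (\1_[set xi : 'rV[R]_d | eps <= enorm xi <= rho] xi)%:C *
    ((enorm xi) ^- d)%:C * fun_of_family (direction xi) (fourier g xi)).

End operator.

(* Main.v *)
Require Import Defs.
From HB Require Import structures.
From mathcomp Require Import all_boot all_order all_algebra.
From mathcomp Require Import spectral.
From mathcomp Require Import complex.
From mathcomp Require Import ring lra.
From mathcomp Require Import all_classical all_reals all_analysis.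
From mathcomp Require Import measurable_realfun ess_sup_inf.

(**
The functional B(z) is only prescribed on Omega(z), so it may be replaced by
b(z) = B(z) pi(z) - (1 - pi(z)) w for a fixed vector w, where pi(z) is the
orthogonal projection onto Omega(z).  The mean M of 1 - pi over the sphere is a
nonnegative matrix with kernel V, and weak cancellation says that the mean of
B pi kills V; hence this mean is in the range of M, and w can be chosen so that
b has mean zero.

It remains to bound, uniformly in the truncation, the kernel
K(x) = int e^(2 pi i <x, xi>) |xi|^-d b(xi / |xi|) d xi.  In polar coordinates
K(x) is the integral over z of b(z) J(<x, z>), where
J(t) = int_eps^rho e^(2 pi i r t) dr / r.  The imaginary part of J is bounded;
the real part is even and, by scaling, Re J(a t) - Re J(a) = O(ln (1 / |t|)) for
|t| <= 1.  Since b has mean zero, Re J(|x|) can be subtracted, and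
ln (1 / |<x / |x|, z>|) is integrable, uniformly in x.
*)

Set Implicit Arguments.
Unset Strict Implicit.
Unset Printing Implicit Defensive.

Import Order.TTheory GRing.Theory Num.Theory.
Import numFieldNormedType.Exports.

Local Open Scope classical_set_scope.
Local Open Scope ring_scope.

(** * Lebesgue measure on R^n *)

Section integrals.
Context d1 d2 (T1 : measurableType d1) (T2 : measurableType d2) (R : realType).
Variables (m1 : {sigma_finite_measure set T1 -> \bar R})
  (m2 : {sigma_finite_measure set T2 -> \bar R}).

(** The obstacle is uniformity in the truncation: the integral of [|xi|^-d] over the annulus is a
    multiple of [ln (rho / eps)], so absolute values lose a logarithm. In the variable [t = ln r]
    the measure [dr / r] is Lebesgue measure and a dilation is a translation. Hence the sine part is
    an integral of [sin (e^t)] over an interval, bounded for all intervals, while the cosine parts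
    in two directions differ only near the endpoints, on intervals whose length is the logarithm of
    the ratio of frequencies.

    A uniform pointwise bound of the kernel is enough, because the truncated operator is a
    convolution with it. Integrability of the logarithm, with a constant independent of the
    direction, follows from volumes of slabs.

    The surface measure is defined through volumes of cones, so every integral over the sphere is
    computed as an integral over the punctured unit ball of a function of the direction; polar
    coordinates then need only Fubini and the scaling of Lebesgue measure. Integrals are real, so
    phases, functions and symbols are split into real and imaginary parts. *)

Lemma measurable_Rintegral (f : T1 * T2 -> R) :
  (m1 \x m2)%E.-integrable setT (EFin \o f) ->
  measurable_fun setT (fun x => \int[m2]_y f (x, y)).
Proof.
move=> fi; apply: measurableT_comp; first exact: fine_measurable.
exact: (measurable_fubini_F fi).
Qed.

(** For almost every [x] the section is integrable, so [fine] loses nothing there; the values of the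
    inner integral elsewhere sit on a null set. *)
Lemma Rintegral_prod (f : T1 * T2 -> R) :
  (m1 \x m2)%E.-integrable setT (EFin \o f) ->
  \int[m1]_x \int[m2]_y f (x, y) = fine (\int[(m1 \x m2)%E]_z (f z)%:E)%E.
Proof.
move=> fi; rewrite -[in RHS]integral12_prod_meas1//.
rewrite /Rintegral; congr fine; apply: ae_eq_integral => //.
- exact/measurable_EFinP/measurable_Rintegral.
- exact: (measurable_fubini_F fi).
apply: filterS (ae_integrable1 fi) => x ix _.
by rewrite fineK//; exact: integrable_fin_num.
Qed.

End integrals.

(** Positive and negative parts are treated separately. If one of them has infinite integral, both
    sides are 0, since [fine] sends infinities to 0 and [c] is positive; so non-integrable [f] is
    covered too. *)
Lemma ge0_integral_comp_Rintegral d (T : measurableType d) (R : realType)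
    (mu : {measure set T -> \bar R}) (phi : T -> T) (c : R) : 0 < c ->
  (forall f : T -> \bar R, measurable_fun setT f -> (forall x, 0 <= f x)%E ->
    (\int[mu]_x f (phi x) = c%:E * \int[mu]_x f x)%E) ->
  forall f : T -> R, measurable_fun setT f ->
    \int[mu]_x f (phi x) = c * \int[mu]_x f x.
Proof.
move=> c0 H f mf; rewrite /Rintegral.
have mf' : measurable_fun setT (EFin \o f) by exact/measurable_EFinP.
rewrite integralE [in RHS]integralE.
rewrite -[X in (\int[_]_x X^\+%E x)%E]/((EFin \o f) \o phi) funepos_comp.
rewrite -[X in (\int[_]_x X^\-%E x)%E]/((EFin \o f) \o phi) funeneg_comp.
rewrite (H (EFin \o f)^\+%E)//; last exact: measurable_funepos.
rewrite (H (EFin \o f)^\-%E)//; last exact: measurable_funeneg.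
have c0' : (0 < c%:E)%E by rewrite lte_fin.
set u := (\int[_]_x _^\+%E x)%E; set v := (\int[_]_x _^\-%E x)%E.
have u0 : (0 <= u)%E by exact: integral_ge0.
have v0 : (0 <= v)%E by exact: integral_ge0.
move: u v u0 v0 => [u| |] [v| |] //= u0 v0.
- by rewrite mulrBr.
- by rewrite gt0_muley//= mulr0.
- by rewrite gt0_muley//= mulr0.
- by rewrite gt0_muley//= mulr0.
Qed.

(** * Lebesgue measure on the line and affine changes of variable *)

Section leb.
Variable R : realType.

(* The library's [lebesgue_measure] lives on the type [measurableTypeR R]; this
   copy lives on [R] with its canonical Borel structure. *)
Definition leb : set R -> \bar R :=
  pushforward (@lebesgue_measure R) (fun x : measurableTypeR R => x : R).

Let mid : measurable_fun setT (fun x : measurableTypeR R => x : R).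
Proof. by move=> _ Y mY; rewrite setTI. Qed.

HB.instance Definition _ := Measure.copy leb
  (measure_function_pushforward__canonical__measure_function_Measure
    (@lebesgue_measure R) mid).

Let leb_sigma_finite : sigma_finite setT leb.
Proof.
have [F FT mF] := sigma_finiteT (@lebesgue_measure R).
by exists F.
Qed.

HB.instance Definition _ := Measure_isSigmaFinite.Build _ _ _ leb
  leb_sigma_finite.

Lemma lebE (A : set R) : leb A = lebesgue_measure A.
Proof. by []. Qed.

Lemma leb_itvcc (p q : R) : p <= q -> leb `[p, q]%classic = (q - p)%:E.
Proof.
rewrite lebE lebesgue_measure_itv/= lte_fin.
rewrite le_eqVlt => /predU1P[->|->]; last by rewrite EFinB.
by rewrite ltxx subrr.
Qed.

Lemma ge0_integral_leb (D : set R) (f : R -> \bar R) : measurable D ->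
  measurable_fun D f -> {in D, forall x, 0 <= f x}%E ->
  (\int[leb]_(x in D) f x = \int[lebesgue_measure]_(x in D) f x)%E.
Proof. by move=> mD mf f0; rewrite ge0_integral_pushforward. Qed.

Lemma integral_leb (D : set R) (f : R -> \bar R) : measurable D ->
  measurable_fun D f ->
  (\int[leb]_(x in D) f x = \int[lebesgue_measure]_(x in D) f x)%E.
Proof.
move=> mD mf; rewrite integralE [RHS]integralE.
by rewrite !ge0_integral_leb//;
  [exact: measurable_funeneg|exact: measurable_funepos].
Qed.

End leb.
Arguments leb R : clear implicits.

Section lebesgue_affine.
Variable R : realType.
Implicit Types (a c : R).

Lemma ge0_integral_affine a c (f : R -> \bar R) : 0 < a ->
  measurable_fun setT f -> (forall x, 0 <= f x)%E ->
  (\int[leb R]_x f (a * x + c)%R =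
   a^-1%:E * \int[leb R]_x f x)%E.
Proof.
move=> a0 mf f0; rewrite !ge0_integral_leb//; last first.
  by apply: measurableT_comp => //; apply: measurable_funD => //;
    exact: measurable_funM.
pose phi (x : R) := a * x + c.
have mphi : measurable_fun [set: measurableTypeR R] (phi : measurableTypeR R ->
  measurableTypeR R).
  by apply: measurable_funD => //; exact: measurable_funM.
pose m := measure_function_pushforward__canonical__measure_function_Measure
  (@lebesgue_measure R) mphi.
have a0' : 0 <= a by exact: ltW.
(* Lebesgue measure is determined by its values on half-open intervals, where the push-forward under
   [phi], multiplied by [a], can be computed. *)
have mE : forall A, measurable A ->
    lebesgue_measure A = mscale (NngNum a0') m A.
  apply: lebesgue_measure_unique => X [[p q]] _ <-.
  transitivity (a%:E * lebesgue_measure (phi @^-1` `]p, q]%classic))%E; last by [].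
  have -> : phi @^-1` `]p, q]%classic = `](p - c) / a, (q - c) / a]%classic.
    apply/seteqP; split => x /=; rewrite !in_itv/= /phi;
    by rewrite ltr_pdivrMr// ler_pdivlMr// ltrBlDr lerBrDr mulrC.
  rewrite !lebesgue_measure_itv/= !lte_fin ltr_pM2r ?invr_gt0// ltrBlDr subrK.
  case: ifPn => _; last by rewrite mule0.
  rewrite -!EFinD -EFinM; congr EFin; field; exact: lt0r_neq0.
have -> : (\int[lebesgue_measure]_x f x =
    a%:E * \int[lebesgue_measure]_x f (a * x + c)%R)%E.
  rewrite (eq_measure_integral (mscale (NngNum a0') m)); last first.
    by move=> A mA _; exact: mE.
  rewrite ge0_integral_mscale//=; congr (_ * _)%E.
  by rewrite ge0_integral_pushforward.
by rewrite muleA -EFinM mulVf ?mul1e// lt0r_neq0.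
Qed.

Lemma Rintegral_affine a c (f : R -> R) : 0 < a -> measurable_fun setT f ->
  \int[leb R]_x f (a * x + c) = a^-1 * \int[leb R]_x f x.
Proof.
move=> a0; apply: (@ge0_integral_comp_Rintegral _ _ _ (leb R)
    (fun x => a * x + c)); first by rewrite invr_gt0.
by move=> g mg g0; exact: ge0_integral_affine.
Qed.

End lebesgue_affine.

(** * Scaling, cubes and slabs in R^n *)

Section lebesgue_rV.
Variable R : realType.
Local Notation leb := (leb R).

Lemma lebesgue_rVS n (A : set 'rV[R]_n.+1) : measurable A ->
  lebesgue_rV R n.+1 A = (leb \x lebesgue_rV R n)%E (@consrV R n @^-1` A).
Proof.
move=> mA; rewrite /= /product_measure1 ge0_integral_leb//.
apply: measurable_fun_xsection; rewrite -[X in measurable X]setTI.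
exact: measurable_consrV.
Qed.

Lemma ge0_integral_rVS n (f : 'rV[R]_n.+1 -> \bar R) :
  measurable_fun setT f -> (forall x, 0 <= f x)%E ->
  (\int[lebesgue_rV R n.+1]_x f x =
   \int[leb]_t \int[lebesgue_rV R n]_y f (consrV (t, y)))%E.
Proof.
move=> mf f0.
have mfc : measurable_fun setT (f \o @consrV R n).
  by apply: measurableT_comp => //; exact: measurable_consrV.
transitivity (\int[(leb \x lebesgue_rV R n)]_z (f \o @consrV R n) z)%E.
  pose m := measure_function_pushforward__canonical__measure_function_Measure
    (leb \x lebesgue_rV R n)%E (@measurable_consrV R n).
  rewrite (eq_measure_integral m); last by move=> A mA _; exact: lebesgue_rVS.
  by rewrite /m ge0_integral_pushforward//; exact: measurable_consrV.
by rewrite (fubini_tonelli1 (f \o @consrV R n))// => x; exact: f0.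
Qed.

Lemma measurable_scale n (s : R) :
  measurable_fun setT (fun x : 'rV[R]_n => s *: x).
Proof.
apply: measurable_fun_rV => i; under eq_fun do rewrite mxE.
by apply: measurable_funM => //; exact: measurable_coord.
Qed.

Lemma scale_consrV n (s t : R) (y : 'rV[R]_n) :
  s *: consrV (t, y) = consrV (s * t, s *: y).
Proof.
apply/rowP => i; rewrite mxE; have [j ->|->] := unliftP ord0 i.
  by rewrite !consrVS mxE.
by rewrite !consrV0.
Qed.

(** Induction on the dimension by Tonelli: the remaining coordinates contribute [s ^- n] and the
    first one a further [s^-1]. *)
Lemma ge0_integral_scale n (s : R) (f : 'rV[R]_n -> \bar R) : 0 < s ->
  measurable_fun setT f -> (forall x, 0 <= f x)%E ->
  (\int[lebesgue_rV R n]_x f (s *: x)%R =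
   (s ^- n)%:E * \int[lebesgue_rV R n]_x f x)%E.
Proof.
move=> s0; elim: n f => [|n IH] f mf f0.
  rewrite expr0 invr1 mul1e; apply: eq_integral => x _.
  by congr f; rewrite [x]thinmx0 scaler0.
have mfs : measurable_fun setT (fun x : 'rV[R]_n.+1 => f (s *: x)).
  by apply: measurableT_comp => //; exact: measurable_scale.
have mfc : measurable_fun setT (f \o @consrV R n).
  by apply: measurableT_comp => //; exact: measurable_consrV.
rewrite !ge0_integral_rVS//.
pose F t := (\int[lebesgue_rV R n]_y f (consrV (t, y)))%E.
have F0 t : (0 <= F t)%E by exact: integral_ge0.
have mF : measurable_fun setT F.
  exact: (measurable_fun_fubini_tonelli_F _ mfc (fun _ => f0 _)).
transitivity (\int[leb]_t ((s ^- n)%:E * F (s * t)%R))%E.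
  apply: eq_integral => t _; under eq_integral do rewrite scale_consrV.
  apply: (IH (fun y => f (consrV ((s * t)%R, y)))) => //.
  by apply: (measurableT_comp mfc); exact: pair1_measurable.
have mFs : measurable_fun setT (fun t => F (s * t)).
  by apply: (measurableT_comp mF); exact: measurable_funM.
have sn0 : 0 <= s ^- n by rewrite invr_ge0 exprn_ge0// ltW.
rewrite (@ge0_integralZl_EFin _ _ _ leb _ measurableT _ (fun x _ => F0 _) mFs _
  sn0).
transitivity ((s ^- n)%:E * (s^-1%:E * \int[leb]_t F t))%E.
  congr (_ * _)%E; rewrite -(ge0_integral_affine 0 s0 mF F0).
  by apply: eq_integral => t _; rewrite addr0.
by rewrite muleA -EFinM exprSr invfM mulrC.
Qed.

Lemma Rintegral_scale n (s : R) (f : 'rV[R]_n -> R) : 0 < s ->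
  measurable_fun setT f ->
  \int[lebesgue_rV R n]_x f (s *: x) = s ^- n * \int[lebesgue_rV R n]_x f x.
Proof.
move=> s0; apply: (@ge0_integral_comp_Rintegral _ _ _ (lebesgue_rV R n)
    (fun x => s *: x)); first by rewrite invr_gt0 exprn_gt0.
by move=> g mg g0; exact: ge0_integral_scale.
Qed.

Definition box n (p : 'rV[R]_n) (r : R) : set 'rV[R]_n :=
  [set x | forall i, `|x 0 i - p 0 i| <= r].

Lemma measurable_box n (p : 'rV[R]_n) (r : R) : measurable (box p r).
Proof.
have -> : box p r = \bigcap_(i in [set: 'I_n])
    ((fun x : 'rV[R]_n => x 0 i) @^-1` `[p 0 i - r, p 0 i + r]%classic).
  apply/seteqP; split => x xb i.
    by move=> _ /=; rewrite in_itv/= -ler_distl; exact: xb.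
  by have := xb i I; rewrite /= in_itv/= -ler_distl.
apply: fin_bigcap_measurable => // i _.
by rewrite -[X in measurable X]setTI; exact: measurable_coord.
Qed.

Lemma lebesgue_box n (p : 'rV[R]_n) (r : R) : 0 <= r ->
  lebesgue_rV R n (box p r) = ((2 * r) ^+ n)%:E.
Proof.
move=> r0; elim: n p => [|n IH] p.
  by rewrite expr0/= diracE mem_set// => -[].
rewrite lebesgue_rVS; last exact: measurable_box.
pose q := \row_i p 0 (lift ord0 i).
have -> : @consrV R n @^-1` box p r =
    `[p 0 ord0 - r, p 0 ord0 + r]%classic `*` box q r.
  apply/seteqP; split => -[t y].
    move=> /= H; split => /=.
      by have := H ord0; rewrite consrV0/= ler_distl in_itv.
    by move=> i; have := H (lift ord0 i); rewrite consrVS mxE.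
  move=> [/= H1 H2] i; have [j ->|->] := unliftP ord0 i.
    by have := H2 j; rewrite consrVS mxE.
  by move: H1; rewrite consrV0/= ler_distl in_itv.
rewrite product_measure1E//; last exact: measurable_box.
rewrite IH /= leb_itvcc; last by lra.
by rewrite -EFinM exprS; congr ((_ * _)%:E); ring.
Qed.

(** The offset [c] serves the induction in [lebesgue_slab]: fixing the first coordinate [t] of a
    point turns [c] into [a 0 ord0 * t + c]. *)
Definition slab n (r : R) (a : 'rV[R]_n) (c delta : R) : set 'rV[R]_n :=
  box 0 r `&` [set x | `|dotr a x + c| <= delta].

Lemma measurable_slab n (r : R) (a : 'rV[R]_n) (c delta : R) :
  measurable (slab r a c delta).
Proof.
apply: measurableI; first exact: measurable_box.
have -> : [set x : 'rV[R]_n | `|dotr a x + c| <= delta] =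
    (fun x => `|dotr a x + c|) @^-1` `]-oo, delta]%classic.
  by apply/seteqP; split => x /=; rewrite in_itv.
rewrite -[X in measurable X]setTI.
suff : measurable_fun setT (fun x : 'rV[R]_n => `|dotr a x + c|).
  by apply.
apply: measurableT_comp => //; apply: measurable_funD => //.
exact: measurable_dotr.
Qed.

Lemma dotr_consrV n (a : 'rV[R]_n.+1) t (y : 'rV[R]_n) :
  dotr a (consrV (t, y)) = a 0 ord0 * t + dotr (\row_i a 0 (lift ord0 i)) y.
Proof.
rewrite /dotr big_ord_recl consrV0; congr (_ + _).
by apply: eq_bigr => i _; rewrite consrVS mxE.
Qed.

(** Fixing all coordinates but the [i]-th confines that one to an interval of length
    [2 * delta / |a_i|], while the others range over a cube of side [2 * r]. The induction removes
    first coordinates until the [i]-th comes first. *)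
Lemma lebesgue_slab n (i : 'I_n) (r : R) (a : 'rV[R]_n) (c delta : R) :
  0 <= r -> 0 <= delta -> a 0 i != 0 ->
  (lebesgue_rV R n (slab r a c delta) <=
   (2 * delta / `|a 0 i| * (2 * r) ^+ n.-1)%:E)%E.
Proof.
move=> r0 delta0; elim: n i a c => [[]//|n IH] i a c ai.
rewrite lebesgue_rVS; last exact: measurable_slab.
pose a' := \row_i a 0 (lift ord0 i).
have mS : measurable (@consrV R n @^-1` slab r a c delta).
  rewrite -[X in measurable X]setTI; apply: measurable_consrV => //.
  exact: measurable_slab.
have slabE t y : slab r a c delta (consrV (t, y)) <->
    `|t| <= r /\ slab r a' (a 0 ord0 * t + c) delta y.
  rewrite /slab/= dotr_consrV -/a' addrAC addrC; split => [[H1 H2]|[H1 [H2 H3]]].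
    split; first by have := H1 ord0; rewrite consrV0 mxE subr0.
    by split => // j; have := H1 (lift ord0 j); rewrite consrVS !mxE.
  split => // j; have [k ->|->] := unliftP ord0 j.
    by have := H2 k; rewrite consrVS !mxE.
  by rewrite consrV0 mxE subr0.
have [j ij|i0] := unliftP ord0 i.
  have aj : a' 0 j != 0 by rewrite mxE -ij.
  have -> : n.+1.-1 = n.-1.+1 by case: n j {IH a a' c ai i mS slabE ij aj} => [[]|].
  rewrite [leLHS]/= /product_measure1/=.
  pose u := 2 * delta / `|a 0 i| * (2 * r) ^+ n.-1.
  have u0 : 0 <= u by rewrite !mulr_ge0 ?invr_ge0// exprn_ge0// mulr_ge0.
  have H : (\int[leb]_t lebesgue_rV R n
        (xsection (@consrV R n @^-1` slab r a c delta) t) <=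
      \int[leb]_(t in `[(- r)%R, r]%classic) u%:E)%E.
    rewrite [leRHS]integral_mkcond; apply: ge0_le_integral => //.
    - exact: measurable_fun_xsection.
    - by apply/(measurable_restrictT _ _).1.
    move=> t _; rewrite patchE; case: ifPn => tr.
      have := IH j a' (a 0 ord0 * t + c) aj; rewrite mxE -ij; apply: le_trans.
      apply: le_measure; rewrite ?inE;
        [exact: measurable_xsection|exact: measurable_slab|].
      by move=> y; rewrite /xsection/= inE/= slabE => -[].
    suff -> : xsection (@consrV R n @^-1` slab r a c delta) t = set0 by rewrite
      measure0.
    apply/seteqP; split => // y; rewrite /xsection/= inE/= slabE => -[+ _].
    by rewrite ler_norml => tr'; move: tr; rewrite notin_setE/= in_itv/= tr'.
  apply: (le_trans H); rewrite integral_cst//= leb_itvcc; last by lra.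
  by rewrite -EFinM lee_fin exprSr /u; rewrite le_eqVlt; apply/orP; left;
    apply/eqP; ring.
(* Now the chosen coordinate is the first one: the section in [t] over each fixed [y] is measured
   first, and the integration over [y] comes last. *)
rewrite i0 in ai *.
pose u := 2 * delta / `|a 0 ord0|.
have u0 : 0 <= u by rewrite !mulr_ge0 ?invr_ge0.
have H : (\int[lebesgue_rV R n]_y leb
      (ysection (@consrV R n @^-1` slab r a c delta) y) <=
    \int[lebesgue_rV R n]_(y in box 0 r) u%:E)%E.
  rewrite [leRHS]integral_mkcond; apply: ge0_le_integral => //.
  - exact: measurable_fun_ysection.
  - by apply/(measurable_restrictT _ _).1 => //; exact: measurable_box.
  move=> y _; rewrite patchE; case: ifPn => yb; last first.
    suff -> : ysection (@consrV R n @^-1` slab r a c delta) y = set0 by rewrite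
      measure0.
    apply/seteqP; split => // t; rewrite /ysection/= inE/= slabE => -[_ [yb' _]].
    by move: yb; rewrite notin_setE.
  (* The centre of the interval of admissible [t]: the solution of
     [a 0 ord0 * t + c + dotr a' y = 0]. *)
  pose v := - (c + dotr a' y) / a 0 ord0.
  apply: (@le_trans _ _ (leb `[v - delta / `|a 0 ord0|, v + delta / `|a 0
    ord0|]%classic)).
    apply: le_measure; rewrite ?inE//; first exact: measurable_ysection.
    move=> t; rewrite /ysection/= inE/= slabE => -[_ [_ /= H]].
    rewrite in_itv/= -ler_distl ler_pdivlMr ?normr_gt0// -normrM.
    apply: le_trans H; rewrite le_eqVlt; apply/orP; left; apply/eqP;
      congr (`|_|); rewrite /v; field.
    by [].
  have d0 : 0 <= delta / `|a 0 ord0| by rewrite divr_ge0.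
  rewrite leb_itvcc; last by lra.
  by rewrite lee_fin /u; rewrite le_eqVlt; apply/orP; left; apply/eqP; ring.
have I : (\int[lebesgue_rV R n]_(y in box 0%R r) u%:E = (u * (2 * r) ^+ n)%:E)%E.
  rewrite integral_cst; last exact: measurable_box.
  by rewrite [RHS]EFinM; congr (_ * _)%E; exact: lebesgue_box.
rewrite I in H; apply: le_trans H.
(* The product measure was unfolded by integrating over [t] last; uniqueness of product measures
   allows the other order. *)
have -> : (leb \x lebesgue_rV R n)%E (@consrV R n @^-1` slab r a c delta) =
    (leb \x^ lebesgue_rV R n)%E (@consrV R n @^-1` slab r a c delta).
  apply: product_measure_unique => // A B mA mB; exact: product_measure2E.
by rewrite /= /product_measure2.
Qed.

End lebesgue_rV.

(** * Domination and Fubini for real-valued integrals *)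

Section Rintegral_bounds.
Context d (T : measurableType d) (R : realType).
Variable mu : {measure set T -> \bar R}.
Implicit Types f g : T -> R.

Lemma Rintegral_indic (D : set T) f :
  \int[mu]_(x in D) f x = \int[mu]_x (\1_D x * f x).
Proof.
rewrite Rintegral_mkcond; apply: eq_Rintegral => x _.
by rewrite patchE indicE; case: ifPn; rewrite ?mul1r ?mul0r.
Qed.

Lemma le_integrable_EFin f g : measurable_fun setT f ->
  (forall x, `|f x| <= g x) ->
  mu.-integrable setT (EFin \o g) -> mu.-integrable setT (EFin \o f).
Proof.
move=> mf fg; apply: le_integrable => //; first exact/measurable_EFinP.
by move=> x _; rewrite /= lee_fin (le_trans (fg x))// ler_norm.
Qed.

Lemma ler_norm_Rintegral f g : measurable_fun setT f ->
  (forall x, `|f x| <= g x) -> mu.-integrable setT (EFin \o g) ->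
  `|\int[mu]_x f x| <= \int[mu]_x g x.
Proof.
move=> mf fg ig; have if_ := le_integrable_EFin mf fg ig.
apply: (le_trans (le_normr_Rintegral measurableT if_)).
apply: le_Rintegral => //.
exact: integrable_norm.
Qed.

Lemma integrable_cst_indic (D : set T) (c : R) : measurable D ->
  (mu D < +oo)%E -> mu.-integrable setT (EFin \o (fun x => c * \1_D x)).
Proof.
move=> mD Doo; apply: (@integrableZl _ _ _ mu setT measurableT c (fun x =>
  (\1_D x)%:E)).
apply/integrableP; split.
  by apply/measurable_EFinP; exact: measurable_indic.
under eq_integral do rewrite gee0_abs ?lee_fin//.
by rewrite integral_indic// setIT.
Qed.

Lemma Rintegral_cst_indic (D : set T) (c : R) : measurable D ->
  (mu D < +oo)%E -> \int[mu]_x (c * \1_D x) = c * fine (mu D).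
Proof.
move=> mD Doo; rewrite -Rintegral_cst// [RHS]Rintegral_indic.
by apply: eq_Rintegral => x _; rewrite mulrC.
Qed.

End Rintegral_bounds.

Section Rintegral_products.
Context d1 d2 (T1 : measurableType d1) (T2 : measurableType d2) (R : realType).
Variables (m1 : {sigma_finite_measure set T1 -> \bar R})
  (m2 : {sigma_finite_measure set T2 -> \bar R}).

Lemma Rintegral_prod2 (f : T1 * T2 -> R) :
  (m1 \x m2)%E.-integrable setT (EFin \o f) ->
  \int[m2]_y \int[m1]_x f (x, y) = fine (\int[(m1 \x m2)%E]_z (f z)%:E)%E.
Proof.
move=> fi; rewrite -[in RHS]integral21_prod_meas1//.
rewrite /Rintegral; congr fine; apply: ae_eq_integral => //.
- apply/measurable_EFinP; apply: measurableT_comp; first exact: fine_measurable.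
  exact: (measurable_fubini_G fi).
- exact: (measurable_fubini_G fi).
apply: filterS (ae_integrable2 fi) => x ix _.
by rewrite fineK//; exact: integrable_fin_num.
Qed.

Lemma Rintegral_Fubini (f : T1 * T2 -> R) :
  (m1 \x m2)%E.-integrable setT (EFin \o f) ->
  \int[m1]_x \int[m2]_y f (x, y) = \int[m2]_y \int[m1]_x f (x, y).
Proof. by move=> fi; rewrite Rintegral_prod// Rintegral_prod2. Qed.

Lemma integrable_Rintegral1 (f : T1 * T2 -> R) :
  (m1 \x m2)%E.-integrable setT (EFin \o f) ->
  m1.-integrable setT (EFin \o (fun x => \int[m2]_y f (x, y))).
Proof.
move=> fi; apply: (le_integrable measurableT _ _ (integrable_fubini_F fi)).
  by apply/measurable_EFinP; exact: (measurable_Rintegral fi).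
move=> x _; rewrite /= /Rintegral /fubini_F.
by case: (integral _ _ _) => [r| |]//=; rewrite ?normr0 ?leey.
Qed.

Lemma integrable_prodM (u : T1 -> R) (v : T2 -> R) :
  m1.-integrable setT (EFin \o u) -> m2.-integrable setT (EFin \o v) ->
  (m1 \x m2)%E.-integrable setT (EFin \o (fun z => u z.1 * v z.2)).
Proof.
move=> iu iv.
have [/measurable_EFinP mu_ u_oo] := integrableP _ _ _ iu.
have [/measurable_EFinP mv_ v_oo] := integrableP _ _ _ iv.
apply/integrable12ltyP.
  apply/measurable_EFinP; apply: measurable_funM.
    by apply: (measurableT_comp mu_); exact: measurable_fst.
  by apply: (measurableT_comp mv_); exact: measurable_snd.
have v_fin : (\int[m2]_y `|(v y)%:E| \is a fin_num)%E.
  by rewrite ge0_fin_numE//; exact: integral_ge0.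
pose V := fine (\int[m2]_y `|(v y)%:E|)%E.
have E x : (\int[m2]_y `|(u x * v y)%:E| = V%:E * `|(u x)%:E|)%E.
  under eq_integral => y _ do rewrite EFinM abseM.
  rewrite (@ge0_integralZl_EFin _ _ _ m2 _ measurableT (fun y => `|(v y)%:E|)%E
    _ _ `|u x|)//.
    by rewrite muleC /V fineK.
  by apply: measurableT_comp => //; exact/measurable_EFinP.
rewrite (eq_integral (fun x => V%:E * `|(u x)%:E|))%E; last first.
  by move=> x _; exact: E.
have V0 : 0 <= V by rewrite fine_ge0//; exact: integral_ge0.
rewrite (@ge0_integralZl_EFin _ _ _ m1 _ measurableT (fun y => `|(u y)%:E|)%E _
  _ V)//.
  by rewrite lte_mul_pinfty.
by apply: measurableT_comp => //; exact/measurable_EFinP.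
Qed.

End Rintegral_products.

Lemma integrable_Rintegral2 d1 d2 (T1 : measurableType d1)
    (T2 : measurableType d2) (R : realType)
    (m1 : {sigma_finite_measure set T1 -> \bar R})
    (m2 : {sigma_finite_measure set T2 -> \bar R}) (f : T1 * T2 -> R) :
  (m1 \x m2)%E.-integrable setT (EFin \o f) ->
  m2.-integrable setT (EFin \o (fun y => \int[m1]_x f (x, y))).
Proof.
move=> fi; have mf : measurable_fun setT (EFin \o f) by move/integrableP: fi => [].
apply: (@integrable_Rintegral1 _ _ _ _ _ m2 m1 (f \o unstable.swap)).
apply/integrable12ltyP; last first.
  have H := iffLR (integrable21ltyP m1 m2 mf) fi. exact: H.
by apply: (measurableT_comp mf); exact: measurable_fun_pair.
Qed.

(** * Euclidean norm and polar coordinates *)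

Section euclidean.
Variables (R : realType) (n : nat).
Implicit Types (x y : 'rV[R]_n) (s : R).

Lemma dotr_scalel s x y : dotr (s *: x) y = s * dotr x y.
Proof. by rewrite /dotr mulr_sumr; apply: eq_bigr => i _; rewrite mxE mulrA. Qed.

Lemma dotr_scaler s x y : dotr x (s *: y) = s * dotr x y.
Proof. by rewrite /dotr mulr_sumr; apply: eq_bigr => i _; rewrite mxE mulrCA. Qed.

Lemma dotr_subl x y z : dotr (x - y) z = dotr x z - dotr y z.
Proof. by rewrite /dotr -sumrB; apply: eq_bigr => i _; rewrite !mxE mulrBl. Qed.

Lemma dotr_ge0 x : 0 <= dotr x x.
Proof. by apply: sumr_ge0 => i _; rewrite -expr2 sqr_ge0. Qed.

Lemma enorm_ge0 x : 0 <= enorm x.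
Proof. exact: sqrtr_ge0. Qed.

Lemma sqr_enorm x : enorm x ^+ 2 = dotr x x.
Proof. by rewrite /enorm sqr_sqrtr// dotr_ge0. Qed.

Lemma enorm_scale s x : enorm (s *: x) = `|s| * enorm x.
Proof.
rewrite /enorm dotr_scalel dotr_scaler mulrA -expr2 sqrtrM ?sqr_ge0//.
by rewrite sqrtr_sqr.
Qed.

Lemma ler_coord_enorm x i : `|x 0 i| <= enorm x.
Proof.
rewrite -sqrtr_sqr /enorm; apply: ler_wsqrtr.
rewrite /dotr (bigD1 i)//= -expr2 lerDl.
by apply: sumr_ge0 => j _; rewrite -expr2 sqr_ge0.
Qed.

Lemma enorm_eq0 x : (enorm x == 0) = (x == 0).
Proof.
apply/eqP/eqP => [x0|->]; last first.
  by rewrite /enorm /dotr big1 ?sqrtr0// => i _; rewrite mxE mul0r.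
apply/rowP => i; rewrite mxE; apply/eqP.
by rewrite -normr_le0 -x0 ler_coord_enorm.
Qed.

Lemma enorm_gt0 x : (0 < enorm x) = (x != 0).
Proof. by rewrite lt_def enorm_ge0 andbT enorm_eq0. Qed.

Lemma ler_enorm_sum x : enorm x <= \sum_i `|x 0 i|.
Proof.
have s0 : 0 <= \sum_i `|x 0 i| by exact: sumr_ge0.
rewrite -(ger0_norm s0) -sqrtr_sqr; apply: ler_wsqrtr.
rewrite /dotr expr2 mulr_suml; apply: ler_sum => i _.
rewrite (le_trans (ler_norm _))// normrM ler_wpM2l//.
by rewrite (bigD1 i)//= lerDl sumr_ge0.
Qed.

(** Cauchy-Schwarz, by expanding the squared norm of [<y, y> x - <x, y> y] and cancelling a factor
    [<y, y>]. *)
Lemma normr_dotr x y : `|dotr x y| <= enorm x * enorm y.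
Proof.
have [->|y0] := eqVneq y 0.
  rewrite /dotr big1 ?normr0 ?mulr_ge0 ?enorm_ge0// => i _.
  by rewrite mxE mulr0.
rewrite -(ler_pXn2r (n := 2))// ?nnegrE ?mulr_ge0 ?enorm_ge0//.
rewrite exprMn !sqr_enorm real_normK ?num_real//.
have yy : 0 < dotr y y by rewrite -sqr_enorm exprn_gt0// enorm_gt0.
have := dotr_ge0 (dotr y y *: x - dotr x y *: y).
have sy (u v : 'rV[R]_n) : dotr u v = dotr v u.
  by apply: eq_bigr => i _; rewrite mulrC.
rewrite dotr_subl !dotr_scalel (sy x) (sy y) !dotr_subl !dotr_scalel (sy y x).
set a := dotr x x; set b := dotr y y; set c := dotr x y => H.
rewrite -(ler_pM2l yy) -/b; lra.
Qed.

Lemma enorm_direction x : x != 0 -> enorm (direction x) = 1.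
Proof.
move=> x0; rewrite /direction enorm_scale ger0_norm ?invr_ge0 ?enorm_ge0//.
by rewrite mulVf// enorm_eq0.
Qed.

Lemma direction_scale s x : 0 < s -> direction (s *: x) = direction x.
Proof.
move=> s0; rewrite /direction enorm_scale gtr0_norm// scalerA invfM mulrAC.
by rewrite mulVf ?mul1r// lt0r_neq0.
Qed.

Lemma directionK x : x != 0 -> enorm x *: direction x = x.
Proof. by move=> x0; rewrite /direction scalerA divff ?scale1r// enorm_eq0. Qed.

Lemma measurable_enormXV (k : nat) :
  measurable_fun setT (fun x : 'rV[R]_n => enorm x ^- k).
Proof.
rewrite (_ : (fun x => _) = (@powR R ^~ (- 1)) \o (fun x => @enorm R n x ^+ k)).
  by apply: measurableT_comp => //; apply: measurable_funX; exact: measurable_enorm.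
by apply/funext => x /=; rewrite powR_inv1// exprn_ge0// enorm_ge0.
Qed.

Lemma sub_ball_box (r : R) : [set x : 'rV[R]_n | enorm x <= r] `<=` box 0 r.
Proof.
by move=> x /= xr i; rewrite mxE subr0 (le_trans (ler_coord_enorm x i)).
Qed.

Lemma measurable_ball (r : R) : measurable [set x : 'rV[R]_n | enorm x <= r].
Proof.
have -> : [set x : 'rV[R]_n | enorm x <= r] = @enorm R n @^-1` `]-oo, r]%classic.
  by apply/seteqP; split => x /=; rewrite in_itv.
by rewrite -[X in measurable X]setTI; exact: measurable_enorm.
Qed.

Lemma lebesgue_sub_ball_lty (r : R) (A : set 'rV[R]_n) : measurable A ->
  A `<=` [set x : 'rV[R]_n | enorm x <= r] -> (lebesgue_rV R n A < +oo)%E.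
Proof.
move=> mA Ar; have [r0|r0] := leP 0 r.
  apply: (@le_lt_trans _ _ (lebesgue_rV R n (box 0 r))).
    apply: le_measure; rewrite ?inE//; first exact: measurable_box.
    by apply: subset_trans Ar _; exact: sub_ball_box.
  by rewrite [X in (X < _)%E](@lebesgue_box R n 0 r r0) ltry.
have -> : A = set0.
  rewrite -subset0 => x /Ar/=; have := enorm_ge0 x; lra.
by rewrite measure0.
Qed.

End euclidean.

(** * Polar coordinates by an exponential weight *)

Section polar.
Variables (R : realType) (n : nat) (n_gt0 : (0 < n)%N).
Local Notation leb := (leb R).
Local Notation lam := (lebesgue_rV R n).
Implicit Types (x : 'rV[R]_n) (t : R).

Definition annulus (eps rho : R) : set 'rV[R]_n :=
  [set x | eps <= enorm x <= rho].

Lemma measurable_annulus eps rho : measurable (annulus eps rho).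
Proof.
have -> : annulus eps rho = @enorm R n @^-1` `[eps, rho]%classic.
  by apply/seteqP; split => x /=; rewrite in_itv.
by rewrite -[X in measurable X]setTI; exact: measurable_enorm.
Qed.

(** The density [n e^(-n t)] on [t >= 0]. Translated so as to start at [ln |x|] it keeps mass one,
    and its product with [|x|^-n] is [n e^(-n t)] on [|x| <= e^t], from which the power of [|x|] has
    disappeared. *)
Let pdf := exponential_pdf (n%:R : R).

Let pdf_ge0 t : 0 <= pdf t.
Proof. exact: exponential_pdf_ge0. Qed.

Let measurable_pdf : measurable_fun setT pdf.
Proof. exact: measurable_exponential_pdf. Qed.

Let integral_pdf_shift (c : R) : (\int[leb]_t (pdf (t + c))%:E = 1)%E.
Proof.
have mp : measurable_fun setT (EFin \o pdf) by exact/measurable_EFinP.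
have E : (\int[leb]_t (EFin \o pdf) t = 1)%E.
  rewrite (ge0_integral_leb measurableT mp (fun t _ => pdf_ge0 t)).
  by apply: integral_exponential_pdf; rewrite ltr0n.
have := @ge0_integral_affine R 1 c (EFin \o pdf) ltr01 mp (fun t => pdf_ge0 t).
rewrite E invr1 mul1e => <-.
by apply: eq_integral => t _; rewrite mul1r.
Qed.

Let measurable_pdf_shift (c : R) : measurable_fun setT (fun t => pdf (t + c)).
Proof. by apply: (measurableT_comp measurable_pdf); exact: measurable_funD. Qed.

Let integrable_pdf_shift (c : R) :
  leb.-integrable setT (EFin \o (fun t => pdf (t + c))).
Proof.
apply/integrableP; split; first exact/measurable_EFinP.
under eq_integral do rewrite gee0_abs ?lee_fin//.
by rewrite integral_pdf_shift ltry.
Qed.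

Section fixed_function.
Variables (f : 'rV[R]_n -> R) (A eps rho : R).
Hypotheses (eps_gt0 : 0 < eps) (eps_rho : eps <= rho).
Hypotheses (mf : measurable_fun setT f)
  (fA : forall x, `|f x| <= A * \1_(annulus eps rho) x).

Let rho_gt0 : 0 < rho. Proof. exact: lt_le_trans eps_rho. Qed.

Let A_ge0 : 0 <= A.
Proof.
(* A point of the annulus, where the bound [fA] forces [0 <= A]. *)
pose x : 'rV[R]_n := \row_i (if i == Ordinal n_gt0 then eps else 0).
have ex : enorm x = eps.
  rewrite /enorm /dotr (bigD1 (Ordinal n_gt0))//= big1 ?addr0 => [|i ni].
    by rewrite !mxE eqxx -expr2 sqrtr_sqr gtr0_norm.
  by rewrite mxE (negbTE ni) mul0r.
have := fA x; rewrite indicE mem_set ?mulr1 /annulus/= ?ex ?lexx//.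
exact: le_trans.
Qed.

Let f_out x : ~ annulus eps rho x -> f x = 0.
Proof.
move=> xA; apply/eqP; rewrite -normr_le0 (le_trans (fA x))//.
by rewrite indicE memNset// mulr0.
Qed.

Let f0 : f 0 = 0.
Proof.
apply: f_out => /=; rewrite /annulus/=.
have /eqP -> : enorm (0 : 'rV[R]_n) == 0 by rewrite enorm_eq0.
by rewrite leNgt eps_gt0.
Qed.

Let measurable_ray x : measurable_fun setT (fun t => f (expR t *: x)).
Proof.
apply: (measurableT_comp mf); apply: measurable_fun_rV => i.
by under eq_fun do rewrite mxE; exact: measurable_funM.
Qed.

(** The ray through [x] meets the annulus in a [t]-interval whose position depends on [x] but whose
    length [ln rho - ln eps] does not; this makes [H] below integrable over the punctured ball. *)
Let ray_bound x t : x != 0 -> `|f (expR t *: x)| <=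
  A * \1_(`[ln eps - ln (enorm x), ln rho - ln (enorm x)]%classic) t.
Proof.
move=> x0; rewrite (le_trans (fA _))// ler_wpM2l// !indicE ler_nat.
have xp : 0 < enorm x by rewrite enorm_gt0.
have [xA|] := boolP (expR t *: x \in annulus eps rho); last by [].
rewrite mem_set//=; move: xA; rewrite inE /annulus/= enorm_scale.
rewrite gtr0_norm ?expR_gt0// => /andP[H1 H2].
rewrite in_itv/= lerBlDr lerBrDr -[t]expRK -lnM ?posrE ?expR_gt0//.
by rewrite !ler_ln ?posrE ?mulr_gt0 ?expR_gt0// H1.
Qed.

Let ln_eps_rho : ln eps <= ln rho.
Proof. by rewrite ler_ln ?posrE. Qed.

Let leb_ray x : leb (`[ln eps - ln (enorm x), ln rho - ln (enorm x)]%classic) =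
  (ln rho - ln eps)%:E.
Proof. by rewrite leb_itvcc ?lerD2r//; congr EFin; ring. Qed.

Lemma integrable_ray x :
  leb.-integrable setT (EFin \o (fun t => f (expR t *: x))).
Proof.
have [->|x0] := eqVneq x 0.
  apply: (eq_integrable measurableT (cst 0%E)); last exact: integrable0.
  by move=> t _; rewrite /= scaler0 f0.
apply: (le_integrable_EFin (measurable_ray x) (fun t => ray_bound t x0)).
by apply: integrable_cst_indic => //; rewrite /= leb_ray ltry.
Qed.

Let w x := f x * enorm x ^- n.

Let measurable_w : measurable_fun setT w.
Proof.
apply: measurable_funM => //.
exact: measurable_enormXV.
Qed.

Lemma integrable_weighted : lam.-integrable setT (EFin \o w).
Proof.
apply: (le_integrable_EFin (g := fun x => A * eps ^- n * \1_(annulus eps rho)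
  x)) => //.
  move=> x; rewrite normrM.
  have [xA|xA] := boolP (x \in annulus eps rho); last first.
    rewrite f_out; last by move: xA; rewrite notin_setE.
    by rewrite normr0 mul0r !mulr_ge0 ?invr_ge0 ?exprn_ge0// ltW.
  have := fA x; rewrite indicE xA !mulr1 => ?.
  move: xA; rewrite inE => /andP[H1 H2].
  have xp : 0 < enorm x by exact: lt_le_trans H1.
  rewrite (ger0_norm (_ : 0 <= enorm x ^- n)) ?invr_ge0 ?exprn_ge0 ?enorm_ge0//.
  apply: ler_pM => //; first by rewrite invr_ge0 exprn_ge0// enorm_ge0.
  by rewrite lef_pV2 ?posrE ?exprn_gt0// lerXn2r ?nnegrE ?enorm_ge0// ltW.
apply: integrable_cst_indic; first exact: measurable_annulus.
apply: (@lebesgue_sub_ball_lty _ _ rho); first exact: measurable_annulus.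
by move=> x /andP[].
Qed.

(** Integrating [G] in [t] gives back [w]. For fixed [t], its integral in [x] becomes, after
    replacing [x] by [e^t x], [n] times that of [H] below. *)
Let G (z : 'rV[R]_n * R) := w z.1 * pdf (z.2 - ln (enorm z.1)).

Let integrable_G : (lam \x leb)%E.-integrable setT (EFin \o G).
Proof.
apply/integrable12ltyP.
  apply/measurable_EFinP; apply: measurable_funM.
    by apply: (measurableT_comp measurable_w); exact: measurable_fst.
  apply: (measurableT_comp measurable_pdf); apply: measurable_funB => //.
  apply: (measurableT_comp (@measurable_ln R)).
  by apply: (measurableT_comp (@measurable_enorm R n)); exact: measurable_fst.
have E x : (\int[leb]_t `|(G (x, t))%:E| = `|(w x)%:E|)%E.
  under eq_integral => t _ do rewrite /G EFinM abseM (gee0_abs (_ : (0 <= (pdf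
    _)%:E)%E)) ?lee_fin//.
  have /integrableP[mp _] := integrable_pdf_shift (- ln (enorm x)).
  have p0 (t : R) : setT t -> (0 <= (EFin \o (fun t => pdf (t - ln (enorm
    x))%R)) t)%E.
    by move=> _; rewrite /= lee_fin; exact: pdf_ge0.
  rewrite (@ge0_integralZl_EFin _ _ _ leb _ measurableT _ p0 mp `|w x|)//.
  by rewrite integral_pdf_shift mule1.
rewrite (eq_integral (fun x => `|(w x)%:E|))%E; last by move=> x _; exact: E.
by have /integrableP[] := integrable_weighted.
Qed.

Let H (z : 'rV[R]_n * R) := \1_(@punctured_ball R n) z.1 * f (expR z.2 *: z.1).

Let measurable_H : measurable_fun setT H.
Proof.
apply: measurable_funM.
  have mI : measurable_fun setT (\1_(@punctured_ball R n) : _ -> R).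
    apply: measurable_indic; exact: measurable_punctured_ball.
  by apply: (measurableT_comp mI); exact: measurable_fst.
apply: (measurableT_comp mf); apply: measurable_fun_rV => i.
under eq_fun do rewrite mxE; apply: measurable_funM.
  by apply: (measurableT_comp (@measurable_expR R)); exact: measurable_snd.
by apply: (measurableT_comp (measurable_coord i)); exact: measurable_fst.
Qed.

Let integrable_H : (lam \x leb)%E.-integrable setT (EFin \o H).
Proof.
have mH : measurable_fun setT (EFin \o H) by exact/measurable_EFinP.
apply/integrable12ltyP => //.
pose B := A * (ln rho - ln eps).
have iB : lam.-integrable setT (EFin \o (fun x => B * \1_(@punctured_ball R n) x)).
  apply: integrable_cst_indic; first exact: measurable_punctured_ball.
  apply: (@lebesgue_sub_ball_lty _ _ 1); first exact: measurable_punctured_ball.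
  by move=> x /andP[].
apply: le_lt_trans (integrable_lty measurableT iB).
have mHa : measurable_fun setT (abse \o (EFin \o H)) by exact: measurableT_comp.
apply: ge0_le_integral => //.
- by move=> x _; exact: integral_ge0.
- exact: (measurable_fun_fubini_tonelli_F (m2 := leb) (abse \o (EFin \o H)) mHa
    (fun z => abse_ge0 ((EFin \o H) z))).
- by move: iB => /integrableP[].
move=> x _; rewrite /H /=.
have [xB|xB] := boolP (x \in @punctured_ball R n); last first.
  rewrite indicE (negbTE xB) mulr0; under eq_integral do rewrite mul0r normr0.
  by rewrite integral0.
have x0 : x != 0 by move: xB; rewrite inE /punctured_ball/= -enorm_gt0 => /andP[].
rewrite indicE xB mulr1 /B.
pose I := `[ln eps - ln (enorm x), ln rho - ln (enorm x)]%classic.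
have mI : measurable I by exact: measurable_itv.
have mI' : measurable_fun setT (fun t => (\1_I t : R)%:E).
  by apply/measurable_EFinP; exact: measurable_indic.
have -> : (A * (ln rho - ln eps))%:E = (\int[leb]_t (A%:E * (\1_I t : R)%:E))%E.
  rewrite (@ge0_integralZl_EFin _ _ _ leb _ measurableT (fun t => (\1_I t :
    R)%:E))//.
    by rewrite integral_indic// setIT /= leb_ray -EFinM.
apply: ge0_le_integral => //.
- apply/measurable_EFinP; apply: measurableT_comp => //.
  by apply: measurable_funM => //; exact: measurable_ray.
- by apply: emeasurable_funM => //; exact: measurable_cst.
by move=> t _; rewrite /= -EFinM lee_fin mul1r; exact: ray_bound.
Qed.

(* [|x|^-n] is the integral over [t >= ln |x|] of [n e^(- n t)]; exchanging the
   integrals and rescaling [x] by [e^t] yields polar coordinates. *)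
Lemma polar_integral : \int[lam]_x (f x / enorm x ^+ n) =
  n%:R * \int[lam]_x (\1_(@punctured_ball R n) x * \int[leb]_t f (expR t *: x)).
Proof.
transitivity (\int[lam]_x \int[leb]_t G (x, t)).
  apply: eq_Rintegral => x _; rewrite /G/= RintegralZl//.
  by rewrite /Rintegral integral_pdf_shift mulr1.
rewrite Rintegral_Fubini//.
transitivity (\int[leb]_t (n%:R * \int[lam]_x H (x, t))).
  apply: eq_Rintegral => t _.
  pose F x := f x * \1_[set y : 'rV[R]_n | enorm y <= expR t] x.
  have mF : measurable_fun setT F.
    by apply: measurable_funM => //; apply: measurable_indic;
      exact: measurable_ball.
  have iF : lam.-integrable setT (EFin \o F).
    apply: (le_integrable_EFin (g := fun x => A * \1_(annulus eps rho) x)) => //.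
      move=> x; rewrite normrM (le_trans _ (fA x))// ler_piMr// indicE.
      by rewrite normr_nat lern1 leq_b1.
    apply: integrable_cst_indic; first exact: measurable_annulus.
    apply: (@lebesgue_sub_ball_lty _ _ rho); first exact: measurable_annulus.
    by move=> x /andP[].
  transitivity (\int[lam]_x (n%:R * expR (- (n%:R * t)) * F x)).
    apply: eq_Rintegral => x _; rewrite /G /F /w/=.
    have [xA|xA] := pselect (annulus eps rho x);
      last by rewrite f_out// !mul0r mulr0.
    have xp : 0 < enorm x by move: xA => /andP[+ _]; exact: lt_le_trans.
    rewrite /pdf /exponential_pdf patchE indicE.
    have -> : (t - ln (enorm x) \in `[0, +oo[%classic) =
        (x \in [set y : 'rV[R]_n | enorm y <= expR t]).
      apply/idP/idP; rewrite !inE/= in_itv/= andbT subr_ge0.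
        by rewrite -{2}(@lnK _ (enorm x)) ?posrE// ler_expR.
      by rewrite -{1}(@lnK _ (enorm x)) ?posrE// ler_expR.
    case: ifPn => _; last by rewrite !mulr0.
    (* The factor [|x|^n] released by the shifted exponential cancels the weight in [w]. *)
    have E : expR (- n%:R * (t - ln (enorm x))) =
        expR (- (n%:R * t)) * enorm x ^+ n.
      by rewrite mulNr mulrBr opprB expRD expRM_natl lnK ?posrE// mulrC.
    rewrite E mulr1 !mulrA; field.
    by rewrite expf_neq0// gt_eqF.
  rewrite RintegralZl// -mulrA; congr (_ * _).
  (* The Jacobian of the dilation is exactly [e^(-n t)], and the ball of radius [e^t] becomes the
     unit ball. *)
  transitivity (\int[lam]_x F (expR t *: x)).
    by rewrite Rintegral_scale ?expR_gt0// expRN expRM_natl.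
  apply: eq_Rintegral => x _; rewrite /F /H/= mulrC.
  have [->|x0] := eqVneq x 0; first by rewrite scaler0 f0 !mulr0.
  rewrite !indicE; congr (_%:R * _); congr nat_of_bool.
  apply/idP/idP; rewrite !inE /punctured_ball/= enorm_scale gtr0_norm ?expR_gt0//.
    by rewrite ger_pMr ?expR_gt0// enorm_gt0 x0.
  by rewrite ger_pMr ?expR_gt0// => /andP[].
rewrite RintegralZl//; last first.
  exact: integrable_Rintegral2.
rewrite -Rintegral_Fubini//; congr (_ * _); apply: eq_Rintegral => x _.
rewrite /H/= RintegralZl//; exact: integrable_ray.
Qed.

End fixed_function.
End polar.

(** * Oscillatory integrals *)

Section oscillatory.
Variable R : realType.
Local Notation leb := (leb R).
Implicit Types (f F h : R -> R) (p q s t : R).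

Lemma integrable_continuous_itv f p q : continuous f ->
  leb.-integrable `[p, q]%classic (EFin \o f).
Proof.
move=> cf; have mf : measurable_fun setT f by exact: continuous_measurable_fun.
have := @continuous_compact_integrable R f `[p, q]%classic (@segment_compact _
  p q) (continuous_subspaceT cf).
move=> /integrableP[_ foo]; apply/integrableP; split.
  by apply/measurable_EFinP; exact: measurable_funTS.
rewrite ge0_integral_leb//; apply/measurable_EFinP.
by apply: measurableT_comp => //; exact: measurable_funTS.
Qed.

Lemma Rintegral_derive f F p q : p < q -> continuous f ->
  (forall x, is_derive x (1 : R) F (f x)) ->
  \int[leb]_(t in `[p, q]) f t = F q - F p.
Proof.
move=> pq cf dF.
have mf : measurable_fun setT f by exact: continuous_measurable_fun.
have cF : continuous F.
  move=> x; apply: differentiable_continuous; apply/derivable1_diffP.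
  by have [] := dF x.
rewrite /Rintegral integral_leb//; last first.
  by apply/measurable_EFinP; exact: measurable_funTS.
rewrite (@continuous_FTC2 _ f F)//.
- exact: continuous_subspaceT.
- split.
  + by move=> x _; have [] := dF x.
  + by apply: cvg_at_right_filter; exact: cF.
  + by apply: cvg_at_left_filter; exact: cF.
- by move=> x _; rewrite derive1E; have [_] := dF x.
Qed.

Lemma normr_sin_le (y : R) : 0 < y -> `|sin y| <= y.
Proof.
move=> y0.
have ds (x : R) : x \in `]0, y[ -> is_derive x (1 : R) (@sin R) (cos x).
  by move=> _; exact: is_derive_sin.
have [c _] := MVT y0 ds (continuous_subspaceT (@continuous_sin R)).
rewrite sin0 !subr0 => ->; rewrite normrM (gtr0_norm y0).
by rewrite ler_piMl ?cos_max// ltW.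
Qed.

Lemma measurable_itvcc_indicM (p q : R) f : measurable_fun setT f ->
  measurable_fun setT (fun t => \1_(`[p, q]%classic) t * f t).
Proof. by move=> mf; apply: measurable_funM => //; exact: measurable_indic. Qed.

Lemma Rintegral_set1_leb f p : measurable_fun setT f ->
  \int[leb]_(t in [set p]) f t = 0.
Proof.
move=> mf; rewrite /Rintegral integral_leb//; last first.
  by apply/measurable_EFinP; exact: measurable_funTS.
exact: Rintegral_set1.
Qed.

Lemma Rintegral_itv_split f p c q : measurable_fun setT f ->
  (forall t, `|f t| <= 1) -> p <= c <= q ->
  \int[leb]_(t in `[p, q]) f t =
  \int[leb]_(t in `[p, c]) f t + \int[leb]_(t in `[c, q]) f t.
Proof.
move=> mf f1 /andP[pc cq].
have if_ : lebesgue_measure.-integrable `[p, q]%classic (EFin \o f).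
  apply: measurable_bounded_integrable => //.
  - by rewrite /= lebesgue_measure_itv/=; case: ifPn => _; rewrite ?ltry.
  - exact: measurable_funTS.
  - by exists 1; split => // M M1 x _ /=; rewrite (le_trans (f1 x))// ltW.
have E u v : \int[leb]_(t in `[u, v]) f t = \int[lebesgue_measure]_(t in `[u,
  v]) f t.
  rewrite /Rintegral integral_leb//.
  by apply/measurable_EFinP; exact: measurable_funTS.
rewrite !E; have := @Rintegral_itvB R f (BLeft p) (BRight q) c if_.
rewrite !bnd_simp => /(_ pc cq) /eqP; rewrite subr_eq => /eqP ->.
rewrite addrC; congr (_ + _); apply: Rintegral_itv_obnd_cbnd.
apply: (integrableS _ _ _ if_) => //.
by move=> x /=; rewrite !in_itv/= => /andP[cx ->];
  rewrite andbT (le_trans pc)// ltW.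
Qed.

(* [- cos (e^t) e^-t] is a primitive of [sin (e^t)] up to an integrable term. *)
Lemma Rintegral_sin_expR_pos p q : 0 <= p -> p < q ->
  `|\int[leb]_(t in `[p, q]) sin (expR t)| <= 3.
Proof.
move=> p0 pq.
pose F := fun t : R => - (cos (expR t) * expR (- t)).
pose g := fun t : R => cos (expR t) * expR (- t).
have ce : continuous (fun t : R => expR (- t)).
  by move=> t; apply: continuous_comp;
    [exact: opp_continuous|exact: continuous_expR].
have cs : continuous (fun t : R => sin (expR t)).
  by move=> t; apply: continuous_comp;
    [exact: continuous_expR|exact: continuous_sin].
have cc : continuous (fun t : R => cos (expR t)).
  by move=> t; apply: continuous_comp;
    [exact: continuous_expR|exact: continuous_cos].
have cg : continuous g by move=> t;
  apply: (@continuousM _ R^o (fun t => cos (expR t)) (fun t => expR (- t)));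
    [exact: cc|exact: ce].
have dF t : is_derive t (1 : R) F (sin (expR t) + g t).
  apply: is_derive_eq.
  have e1 : expR (- t) * expR t = 1 by rewrite -expRD addNr expR0.
  rewrite /GRing.scale/= /g.
  transitivity (cos (expR t) * expR (- t) + sin (expR t) * (expR (- t) * expR t)).
    by ring.
  by rewrite e1; ring.
have dE t : is_derive t (1 : R) (fun t => - expR (- t)) (expR (- t)).
  by apply: is_derive_eq; rewrite mulrN1 opprK.
have cF : continuous (fun t => sin (expR t) + g t).
  by move=> t; apply: (@continuousD _ R^o R^o (fun t => sin (expR t)) g);
    [exact: cs|exact: cg].
have := Rintegral_derive pq cF dF; rewrite RintegralD//; last 2 first.
  exact: integrable_continuous_itv.
  exact: integrable_continuous_itv.
move=> E.
have g1 : `|\int[leb]_(t in `[p, q]) g t| <= 1.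
  have : `|\int[leb]_(t in `[p, q]) g t| <= \int[leb]_(t in `[p, q]) expR (- t).
    apply: le_trans (le_normr_Rintegral _ _) _ => //.
      exact: integrable_continuous_itv.
    apply: le_Rintegral => //; [|exact: integrable_continuous_itv|].
      by apply: integrable_continuous_itv => t; apply: continuous_comp;
        [exact: cg|exact: norm_continuous].
    move=> t _; rewrite normrM [X in _ * X]gtr0_norm ?expR_gt0//.
    by rewrite ler_piMl ?cos_max// expR_ge0.
  move=> /le_trans; apply; rewrite (Rintegral_derive pq ce dE).
  have : expR (- p) <= 1 by rewrite -[leRHS]expR0 ler_expR oppr_le0.
  by have := expR_gt0 (- q); lra.
(* The two boundary terms contribute at most 1 each, which together with [g1] makes 3. *)
have F1 t : 0 <= t -> `|F t| <= 1.
  move=> t0; rewrite normrN normrM mulr_ile1// ?cos_max//.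
  by rewrite gtr0_norm ?expR_gt0// -[leRHS]expR0 ler_expR oppr_le0.
move: E; have := F1 p p0; have := F1 q (le_trans p0 (ltW pq)).
move: g1; rewrite !ler_norml; lra.
Qed.

Lemma measurable_sin_expR : measurable_fun setT (fun t : R => sin (expR t)).
Proof.
apply: continuous_measurable_fun => t.
by apply: continuous_comp; [exact: continuous_expR|exact: continuous_sin].
Qed.

(** On [t <= 0] there is no oscillation, but [|sin (e^t)| <= e^t] has integral at most 1; the part
    in [t >= 0] contributes at most 3. *)
Lemma Rintegral_sin_expR p q : p <= q ->
  `|\int[leb]_(t in `[p, q]) sin (expR t)| <= 4.
Proof.
have pos u v : 0 <= u -> u <= v -> `|\int[leb]_(t in `[u, v]) sin (expR t)| <= 3.
  move=> u0; rewrite le_eqVlt => /predU1P[->|uv];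
    last exact: Rintegral_sin_expR_pos.
  by rewrite set_itv1 (Rintegral_set1_leb _ measurable_sin_expR) normr0.
have neg u v : v <= 0 -> u <= v -> `|\int[leb]_(t in `[u, v]) sin (expR t)| <= 1.
  move=> v0; rewrite le_eqVlt => /predU1P[->|uv].
    by rewrite set_itv1 (Rintegral_set1_leb _ measurable_sin_expR) normr0.
  have cs : continuous (fun t : R => sin (expR t)).
    by move=> t; apply: continuous_comp;
      [exact: continuous_expR|exact: continuous_sin].
  have dE t : is_derive t (1 : R) expR (expR t) by exact: is_derive_expR.
  apply: (@le_trans _ _ (\int[leb]_(t in `[u, v]) expR t)).
    apply: le_trans (le_normr_Rintegral _ _) _ => //.
      exact: integrable_continuous_itv.
    apply: le_Rintegral => //.
    - by apply: integrable_continuous_itv => t; apply: continuous_comp;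
        [exact: cs|exact: norm_continuous].
    - by apply: integrable_continuous_itv => t; exact: continuous_expR.
    by move=> t _; rewrite normr_sin_le// expR_gt0.
  rewrite (Rintegral_derive uv (@continuous_expR R) dE).
  have : expR v <= 1 by rewrite -[leRHS]expR0 ler_expR.
  by have := expR_gt0 u; lra.
move=> pq; have [p0|p0] := leP 0 p; first by have := pos _ _ p0 pq; lra.
have [q0|q0] := leP q 0; first by have := neg _ _ q0 pq; lra.
rewrite (@Rintegral_itv_split _ _ 0 _ measurable_sin_expR)//.
- have := neg p 0 (lexx _) (ltW p0); have := pos 0 q (lexx _) (ltW q0).
  by rewrite !ler_norml; lra.
- by move=> t; exact: sin_max.
- by rewrite !ltW.
Qed.

End oscillatory.

(** * Integrals in dr / r and their behaviour under rescaling *)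

Section osc.
Variable R : realType.
Local Notation leb := (leb R).
Implicit Types (h : R -> R) (p q s t a tau : R).

(* [osc h p q tau] is the integral of [h (r * tau) dr / r] over [e^p, e^q], in
   the variable [t = ln r]. *)
Definition osc h p q tau : R := \int[leb]_(t in `[p, q]) h (expR t * tau).

Lemma oscE h p q tau :
  osc h p q tau = \int[leb]_t (\1_(`[p, q]%classic) t * h (expR t * tau)).
Proof. by rewrite /osc Rintegral_indic. Qed.

Variable h : R -> R.
Hypotheses (mh : measurable_fun setT h) (h1 : forall t, `|h t| <= 1).

Lemma measurable_osc_fun tau : measurable_fun setT (fun t => h (expR t * tau)).
Proof. by apply: (measurableT_comp mh); exact: measurable_funM. Qed.

(** The measure [dr / r] is invariant under dilations: multiplying the frequency by [e^s] only
    translates the interval of [t]. *)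
Lemma osc_shift p q s a : osc h p q (expR s * a) = osc h (p + s) (q + s) a.
Proof.
rewrite !oscE.
have -> : \int[leb]_t (\1_(`[p + s, q + s]%classic) t * h (expR t * a)) =
   \int[leb]_t (\1_(`[p + s, q + s]%classic) (1 * t + s) * h (expR (1 * t + s)
     * a)).
  have := @Rintegral_affine R 1 s _ ltr01
    (measurable_itvcc_indicM (p + s) (q + s) (measurable_osc_fun a)).
  by move=> ->; rewrite invr1 mul1r.
apply: eq_Rintegral => t _; rewrite mul1r expRD mulrA; congr (_ * _).
by rewrite !indicE; congr (_%:R); congr nat_of_bool; apply/idP/idP;
  rewrite !inE/= !in_itv/= !lerD2r.
Qed.

Let integrable_itv_indic p q c : p <= q ->
  leb.-integrable setT (EFin \o (fun t => c * \1_(`[p, q]%classic) t)).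
Proof.
by move=> pq; apply: integrable_cst_indic => //; rewrite /= leb_itvcc// ltry.
Qed.

Let integrable_osc_fun p q tau : p <= q ->
  leb.-integrable setT
    (EFin \o (fun t => \1_(`[p, q]%classic) t * h (expR t * tau))).
Proof.
move=> pq; apply: (le_integrable_EFin _ _ (integrable_itv_indic 1 pq)).
  exact: measurable_itvcc_indicM (measurable_osc_fun tau).
move=> t; rewrite normrM mul1r ger0_norm ?indicE//.
by rewrite ler_piMr.
Qed.

(* Rescaling the frequency translates the variable [t], so the two integrals
   differ only on two intervals of length [- s]. *)
Lemma normr_osc_shift p q s a : p <= q -> s <= 0 ->
  `|osc h p q (expR s * a) - osc h p q a| <= 2 * - s.
Proof.
move=> pq s0; rewrite osc_shift !oscE -RintegralB//; last 2 first.
- by apply: integrable_osc_fun; rewrite lerD2r.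
- exact: integrable_osc_fun.
have ps : p + s <= p by lra.
have qs : q + s <= q by lra.
have ib : leb.-integrable setT (EFin \o (fun t =>
   1 * \1_(`[p + s, p]%classic) t + 1 * \1_(`[q + s, q]%classic) t)).
  exact: (integrableD measurableT (integrable_itv_indic 1 ps)
    (integrable_itv_indic 1 qs)).
apply: le_trans (ler_norm_Rintegral _ _ ib) _.
- by apply: measurable_funB; exact: measurable_itvcc_indicM (measurable_osc_fun a).
- move=> t; rewrite -mulrBl normrM (@le_trans _ _ `|\1_(`[p + s, q +
    s]%classic) t - \1_(`[p, q]%classic) t : R|)//.
    by rewrite ler_piMr.
  rewrite !mul1r !indicE.
  (* The two indicators differ only on [[p + s, p]] and [[q + s, q]]. The cases on the position of
     [t] relative to the four endpoints also cover disjoint intervals. *)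
  have mE u v : (t \in `[u, v]%classic) = (u <= t <= v) by rewrite mem_setE in_itv.
  rewrite !mE.
  have [?|?] := leP p t; have [?|?] := leP (p + s) t; have [?|?] := leP t q;
    have [?|?] := leP t (q + s); have [?|?] := leP t p; have [?|?] := leP (q + s) t;
    rewrite /= ?subrr ?subr0 ?sub0r ?normr0 ?normrN ?normr1 //; lra.
rewrite RintegralD//; [|exact: integrable_itv_indic..].
by rewrite !Rintegral_cst_indic//= ?leb_itvcc ?ltry//=; lra.
Qed.

End osc.

Section osc_trigonometric.
Variable R : realType.
Implicit Types (p q a tau : R).

(** For [tau > 0], writing [2 * pi * tau] as [e^s] gives the integral of [sin (e^t)] over a
    translated interval, for which the bound is independent of the endpoints. Oddness gives
    [tau < 0]. *)
Lemma normr_osc_sin p q tau : p <= q ->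
  `|osc (fun u => sin (2 * pi * u)) p q tau| <= 4.
Proof.
move=> pq.
have pos u : 0 < u -> `|osc (fun u => sin (2 * pi * u)) p q u| <= 4.
  move=> u0; have v0 : 0 < 2 * pi * u by rewrite !mulr_gt0 ?pi_gt0.
  have -> : osc (fun u => sin (2 * pi * u)) p q u = osc sin p q (expR (ln (2 *
    pi * u)) * 1).
    by apply: eq_Rintegral => t _; rewrite lnK ?posrE//; congr (sin _); ring.
  rewrite osc_shift; last exact: continuous_measurable_fun (@continuous_sin R).
  have := @Rintegral_sin_expR R (p + ln (2 * pi * u)) (q + ln (2 * pi * u)).
  rewrite lerD2r => /(_ pq); congr (`|_| <= _).
  by apply: eq_Rintegral => t _; rewrite mulr1.
have [t0|t0|t0] := ltgtP 0 tau; first exact: pos.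
  have -> : osc (fun u => sin (2 * pi * u)) p q tau = - osc (fun u => sin (2 *
    pi * u)) p q (- tau).
    rewrite /osc -mulN1r -RintegralZl//; last first.
      apply: integrable_continuous_itv => t.
      apply: (@continuous_comp _ _ _ (fun t => 2 * pi * (expR t * - tau)) sin);
        last exact: continuous_sin.
      apply: (@continuousM _ R^o (fun=> 2 * pi) (fun t => expR t * - tau));
        first exact: cst_continuous.
      apply: (@continuousM _ R^o expR (fun=> - tau)); last exact: cst_continuous.
      exact: continuous_expR.
    by apply: eq_Rintegral => t _; rewrite mulN1r !mulrN sinN opprK.
  by rewrite normrN pos// oppr_gt0.
have -> : osc (fun u => sin (2 * pi * u)) p q tau = \int[leb R]_(t in `[p, q]) 0.
  by apply: eq_Rintegral => t _; rewrite -t0 !mulr0 sin0.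
by rewrite Rintegral_cst// mul0r normr0.
Qed.

(** By evenness [tau] may be replaced by [|tau| = e^s] with [s = ln |tau| <= 0]. Only a difference
    can be bounded: at frequency 0 the cosine integral is [q - p], unbounded over all
    truncations. *)
Lemma normr_osc_cos p q a tau : p <= q -> 0 < `|tau| <= 1 ->
  `|osc (fun u => cos (2 * pi * u)) p q (a * tau) -
    osc (fun u => cos (2 * pi * u)) p q a| <= 2 * - ln `|tau|.
Proof.
move=> pq /andP[t0 t1].
have even : osc (fun u => cos (2 * pi * u)) p q (a * tau) =
    osc (fun u => cos (2 * pi * u)) p q (expR (ln `|tau|) * a).
  apply: eq_Rintegral => t _; rewrite lnK ?posrE//.
  have [u0|u0] := leP 0 tau.
    by rewrite ger0_norm//; congr cos; ring.
  by rewrite ltr0_norm// -[RHS]cosN; congr cos; ring.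
rewrite even; apply: normr_osc_shift => //.
- apply: (measurableT_comp (continuous_measurable_fun (@continuous_cos R))).
  exact: measurable_funM.
- by move=> t; exact: cos_max.
- by rewrite -ln1 ler_ln ?posrE.
Qed.

End osc_trigonometric.

(** * The kernel of a mean-zero multiplier *)

Section kernel.
Variables (R : realType) (n : nat) (n_gt0 : (0 < n)%N).
Local Notation leb := (leb R).
Local Notation lam := (lebesgue_rV R n).
Local Notation PB := (@punctured_ball R n).
Variables (m : 'rV[R]_n -> R) (A : R).
Hypotheses (mm : measurable_fun setT m) (mA : forall x, `|m x| <= A)
  (m_homo : forall (s : R) (x : 'rV[R]_n), 0 < s -> m (s *: x) = m x).

Let A_ge0 : 0 <= A. Proof. exact: le_trans (mA 0). Qed.

Lemma lebesgue_punctured_ball_lty : (lam PB < +oo)%E.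
Proof.
apply: (@lebesgue_sub_ball_lty _ _ 1); first exact: measurable_punctured_ball.
by move=> x /andP[].
Qed.

Definition kernel (h : R -> R) (eps rho : R) (y : 'rV[R]_n) : R :=
  \int[lam]_x (\1_(@annulus R n eps rho) x * m x * h (dotr y x) / enorm x ^+ n).

Section fixed_parameters.
Variables (h : R -> R) (eps rho : R).
Hypotheses (mh : measurable_fun setT h) (h1 : forall t, `|h t| <= 1).
Hypotheses (eps_gt0 : 0 < eps) (eps_rho : eps <= rho).

Let rho_gt0 : 0 < rho. Proof. exact: lt_le_trans eps_rho. Qed.

Let ln_eps_rho : ln eps <= ln rho.
Proof. by rewrite ler_ln ?posrE. Qed.

(** The ray integral given by [polar_integral] has limits depending on [|x|]; translating [t] by
    [ln |x|] replaces [x] by its direction and the limits by [ln eps] and [ln rho]. Homogeneity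
    takes [m] out of the ray integral. *)
Lemma kernelE y : kernel h eps rho y = n%:R * \int[lam]_x
  (\1_PB x * (m x * osc h (ln eps) (ln rho) (dotr y (direction x)))).
Proof.
pose f x := \1_(@annulus R n eps rho) x * m x * h (dotr y x).
have mdot : measurable_fun setT (fun x : 'rV[R]_n => dotr y x).
  exact: measurable_dotr.
have mf : measurable_fun setT f.
  apply: measurable_funM; last exact: (measurableT_comp mh).
  apply: measurable_funM => //; apply: measurable_indic; exact: measurable_annulus.
have fA x : `|f x| <= A * \1_(@annulus R n eps rho) x.
  rewrite /f !normrM (ger0_norm (_ : 0 <= \1_(@annulus R n eps rho) x)) ?indicE//.
  rewrite -mulrA mulrC ler_wpM2r//.
  by rewrite -[leRHS]mulr1 ler_pM.
rewrite /kernel (polar_integral n_gt0 eps_gt0 eps_rho mf fA).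
congr (_ * _); apply: eq_Rintegral => x _; rewrite indicE.
have [xB|xB] := boolP (x \in PB); last by rewrite !mul0r.
congr (_ * _).
have x0 : x != 0 by move: xB; rewrite inE /punctured_ball/= -enorm_gt0 => /andP[].
have xp : 0 < enorm x by rewrite enorm_gt0.
pose F (s : R) := m x * (\1_(`[ln eps, ln rho]%classic) s * h (expR s * dotr y
  (direction x))).
have mF : measurable_fun setT F.
  by apply: measurable_funM => //; apply: measurable_itvcc_indicM;
    exact: measurable_osc_fun.
transitivity (\int[leb]_t F t).
  transitivity (\int[leb]_t F (1 * t + ln (enorm x))); last first.
    by rewrite Rintegral_affine// invr1 mul1r.
  apply: eq_Rintegral => t _; rewrite mul1r /F /f m_homo ?expR_gt0//.
  have dE : expR (t + ln (enorm x)) * dotr y (direction x) = dotr y (expR t *: x).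
    by rewrite expRD lnK ?posrE// -mulrA -!dotr_scaler directionK.
  rewrite dE mulrA [m x * _]mulrC; congr (_ * _ * _).
  have lE : t + ln (enorm x) = ln (expR t * enorm x).
    by rewrite lnM ?posrE ?expR_gt0// expRK.
  rewrite !indicE lE; congr (nat_of_bool _)%:R; apply/idP/idP;
    rewrite !inE /annulus/= in_itv/= enorm_scale gtr0_norm ?expR_gt0//;
    by rewrite !ler_ln ?posrE ?mulr_gt0 ?expR_gt0.
rewrite oscE /F RintegralZl//.
apply: (le_integrable_EFin (g := fun t => 1 * \1_(`[ln eps, ln rho]%classic) t)).
- by apply: measurable_itvcc_indicM; exact: measurable_osc_fun.
- by move=> t; rewrite normrM mul1r ger0_norm ?indicE// ler_piMr.
by apply: integrable_cst_indic => //; rewrite /= leb_itvcc// ltry.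
Qed.

(** Since [osc] is itself an integral, its measurability and integrability in [x] come from Fubini
    on the product of the punctured ball and the [t]-interval. *)
Lemma integrable_osc_direction y : lam.-integrable setT (EFin \o
  (fun x => \1_PB x * osc h (ln eps) (ln rho) (dotr y (direction x)))).
Proof.
pose F (z : 'rV[R]_n * R) := \1_PB z.1 *
  (\1_(`[ln eps, ln rho]%classic) z.2 * h (expR z.2 * dotr y (direction z.1))).
have iF : (lam \x leb)%E.-integrable setT (EFin \o F).
  apply: (le_integrable_EFin (g := fun z => (1 * \1_PB z.1) *
     (1 * \1_(`[ln eps, ln rho]%classic) z.2))).
  - apply: measurable_funM.
      have mI : measurable_fun setT (\1_PB : _ -> R).
        by apply: measurable_indic; exact: measurable_punctured_ball.
      by apply: (measurableT_comp mI); exact: measurable_fst.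
    apply: measurable_funM.
      have mI : measurable_fun setT (\1_(`[ln eps, ln rho]%classic) : _ -> R).
        by apply: measurable_indic.
      by apply: (measurableT_comp mI); exact: measurable_snd.
    apply: (measurableT_comp mh); apply: measurable_funM.
      by apply: (measurableT_comp (@measurable_expR R)); exact: measurable_snd.
    apply: measurable_dotr => //.
    by apply: (measurableT_comp (@measurable_direction R n)); exact: measurable_fst.
  - move=> z; rewrite /F !normrM !mul1r (ger0_norm (_ : 0 <= \1_PB z.1)) ?indicE//.
    by rewrite ler_wpM2l// ger0_norm// ler_piMr.
  apply: (@integrable_prodM _ _ _ _ _ lam leb (fun x => 1 * \1_PB x)
    (fun t => 1 * \1_(`[ln eps, ln rho]%classic) t));
      apply: integrable_cst_indic => //.
  - exact: measurable_punctured_ball.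
  - exact: lebesgue_punctured_ball_lty.
  - by rewrite /= leb_itvcc// ltry.
apply: (eq_integrable measurableT (EFin \o (fun x => \int[leb]_t F (x, t))));
  last exact: integrable_Rintegral1.
move=> x _ /=; congr EFin.
rewrite oscE /F/= RintegralZl//.
apply: (le_integrable_EFin (g := fun t => 1 * \1_(`[ln eps, ln rho]%classic) t)).
- by apply: measurable_itvcc_indicM; exact: measurable_osc_fun.
- by move=> t; rewrite normrM mul1r ger0_norm ?indicE// ler_piMr.
by apply: integrable_cst_indic => //; rewrite /= leb_itvcc// ltry.
Qed.

Lemma integrable_m_osc_direction y : lam.-integrable setT (EFin \o
  (fun x => \1_PB x * (m x * osc h (ln eps) (ln rho) (dotr y (direction x))))).
Proof.
have ir := integrable_osc_direction y.
have /integrableP[/measurable_EFinP mr _] := ir.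
apply: (le_integrable_EFin (g := fun x => A *
   `|\1_PB x * osc h (ln eps) (ln rho) (dotr y (direction x))|)).
- under eq_fun do rewrite mulrCA; exact: measurable_funM.
- by move=> x; rewrite mulrCA normrM ler_wpM2r.
exact: (@integrableZl _ _ _ lam setT measurableT A _ (integrable_norm ir)).
Qed.

End fixed_parameters.

(** The ray integral is at most 4 in every direction, so the constant is [n] times [4 * A] times the
    volume of the ball. *)
Lemma kernel_sin_bounded : exists C : R, forall eps rho y, 0 < eps -> eps <= rho ->
  `|kernel (fun u => sin (2 * pi * u)) eps rho y| <= C.
Proof.
exists (n%:R * (4 * A * fine (lam PB))) => eps rho y e0 er.
have l01 : ln eps <= ln rho by rewrite ler_ln ?posrE// (lt_le_trans e0).
have mh : measurable_fun setT (fun u : R => sin (2 * pi * u)).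
  apply: (measurableT_comp (continuous_measurable_fun (@continuous_sin R))).
  exact: measurable_funM.
have h1 (t : R) : `|sin (2 * pi * t)| <= 1 by exact: sin_max.
rewrite kernelE// normrM normr_nat ler_wpM2l//.
have mPB := @measurable_punctured_ball R n.
have ic := @integrable_cst_indic _ _ _ lam _ (4 * A) mPB
  lebesgue_punctured_ball_lty.
have /integrableP[/measurable_EFinP mr _] := integrable_m_osc_direction mh h1
  e0 er y.
apply: le_trans (ler_norm_Rintegral mr _ ic) _ => [x|].
  rewrite !normrM [`|\1_PB x|]ger0_norm ?indicE// mulrC ler_wpM2r// mulrC ler_pM//.
  exact: normr_osc_sin.
by rewrite Rintegral_cst_indic//; exact: lebesgue_punctured_ball_lty.
Qed.

(* [- ln |tau|] is at most the number of [k] such that [|tau| <= e^-k], and the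
   volumes of the corresponding slabs form a geometric series. *)
Section log_slabs.
Variables (e : 'rV[R]_n).
Hypothesis e1 : enorm e = 1.

Let S (k : nat) : set 'rV[R]_n := slab 1 e 0 (expR (- k%:R)).

(** The slab estimate with [r = 1], [|e_i| >= 1 / n] and half-width at most [2 / 2^(k+1)] gives
    [D / 2^(k+1)]; over all [k] these sum to [D]. *)
Let D : R := 4 * n%:R * 2 ^+ n.-1.

Let D_ge0 : 0 <= D. Proof. by rewrite !mulr_ge0 ?exprn_ge0. Qed.

Let expR_le_half (k : nat) : expR (- k%:R) <= 2 / 2 ^+ k.+1 :> R.
Proof.
rewrite exprS invfM mulrA divff ?mul1r// expRN lef_pV2 ?posrE ?exprn_gt0
  ?expR_gt0//.
rewrite -[k%:R]mulr1 expRM_natl lerXn2r ?nnegrE ?expR_ge0//.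
by have := @expR_ge1Dx R 1.
Qed.

Let lebesgue_log_slab (k : nat) : (lam (S k) <= (D / (2 ^ k.+1)%:R)%:E)%E.
Proof.
(* The absolute values of the coordinates of a unit vector sum to at least 1, so one of them is at
   least [1 / n]. This keeps the constant independent of [e]. *)
have [i ei] : exists i, n%:R^-1 <= `|e 0 i|.
  apply/existsP; apply: contraT; rewrite negb_exists => /forallP H.
  have : \sum_i `|e 0 i| < \sum_(i < n) n%:R^-1.
    apply: ltr_sum; first by apply/hasP; exists (Ordinal n_gt0);
      rewrite ?mem_index_enum.
    by move=> i _; rewrite ltNge.
  rewrite sumr_const card_ord -[X in _ < X]mulr_natr mulVf ?pnatr_eq0 -?lt0n//
    => s1.
  by have := ler_enorm_sum e; rewrite e1 leNgt s1.
have n0 : 0 < n%:R :> R by rewrite ltr0n.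
have ei0 : 0 < `|e 0 i| by apply: lt_le_trans ei; rewrite invr_gt0.
have := @lebesgue_slab R n i 1 e 0 (expR (- k%:R)) ler01 (expR_ge0 _).
rewrite -normr_gt0 => /(_ ei0) /le_trans; apply; rewrite lee_fin mulr1.
have -> : D / (2 ^ k.+1)%:R = 2 * (2 / 2 ^+ k.+1) * n%:R * 2 ^+ n.-1.
  by rewrite /D natrX; field; rewrite expf_neq0.
rewrite ler_wpM2r ?exprn_ge0// ler_pM ?mulr_ge0 ?invr_ge0 ?expR_ge0//.
  by rewrite ler_wpM2l.
by rewrite -[leRHS]invrK lef_pV2 ?posrE ?invr_gt0.
Qed.

Lemma integral_log_slabs :
  (\int[lam]_x \sum_(k <oo) (\1_(S k) x : R)%:E <= D%:E)%E.
Proof.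
have mS k : measurable (S k) by exact: measurable_slab.
rewrite integral_nneseries//; last first.
  by move=> k; apply/measurable_EFinP; exact: measurable_indic.
apply: le_trans (epsilon_trick0 xpredT D_ge0).
apply: lee_nneseries => [k *|k *].
  exact: integral_ge0.
by rewrite integral_indic// setIT; exact: lebesgue_log_slab.
Qed.

Lemma log_slabs_ge (x : 'rV[R]_n) (N : nat) : enorm x <= 1 ->
  (forall k, (k < N)%N -> `|dotr e x| <= expR (- k%:R)) ->
  (N%:R%:E <= \sum_(k <oo) (\1_(S k) x : R)%:E)%E.
Proof.
move=> x1 H; apply: le_trans (nneseries_lim_ge N _) => //.
rewrite (eq_big_nat _ _ (F2 := fun=> 1%E)) => [|k /andP[_ kN]].
  by rewrite sumEFin sumr_const_nat subn0.
rewrite indicE mem_set//; split.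
  by apply: (@sub_ball_box _ _ 1) => /=.
by rewrite /= addr0 H.
Qed.

End log_slabs.

Hypothesis m_mean : \int[lam]_x (\1_PB x * m x) = 0.

Lemma kernel_cos_bounded : exists C : R, forall eps rho y, 0 < eps -> eps <= rho ->
  `|kernel (fun u => cos (2 * pi * u)) eps rho y| <= C.
Proof.
pose D : R := 4 * n%:R * 2 ^+ n.-1.
exists (n%:R * (A * 2 * D)) => eps rho y e0 er.
have D_ge0 : 0 <= D by rewrite !mulr_ge0 ?exprn_ge0.
have l01 : ln eps <= ln rho by rewrite ler_ln ?posrE// (lt_le_trans e0).
pose h := (fun u : R => cos (2 * pi * u)).
have mh : measurable_fun setT h.
  apply: (measurableT_comp (continuous_measurable_fun (@continuous_cos R))).
  exact: measurable_funM.
have h1 (t : R) : `|h t| <= 1 by exact: cos_max.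
rewrite kernelE// normrM normr_nat ler_wpM2l//.
have mPB := @measurable_punctured_ball R n.
(* The comparison value depends on [|y|] but not on [x], so [m_mean] makes its contribution
   vanish. *)
pose c := osc h (ln eps) (ln rho) (enorm y).
pose J x := osc h (ln eps) (ln rho) (dotr y (direction x)).
have ij := integrable_m_osc_direction mh h1 e0 er y.
have im : lam.-integrable setT (EFin \o (fun x => c * (\1_PB x * m x))).
  apply: (@integrableZl _ _ _ lam setT measurableT c (EFin \o (fun x => \1_PB x
    * m x))).
  apply: (le_integrable_EFin (g := fun x => A * \1_PB x)).
  - by apply: measurable_funM => //; exact: measurable_indic.
  - by move=> x; rewrite normrM ger0_norm ?indicE// mulrC ler_wpM2r.
  by apply: integrable_cst_indic => //; exact: lebesgue_punctured_ball_lty.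
have -> : \int[lam]_x (\1_PB x * (m x * osc h (ln eps) (ln rho) (dotr y
  (direction x)))) =
    \int[lam]_x (\1_PB x * (m x * J x) - c * (\1_PB x * m x)).
  rewrite RintegralB//; rewrite [X in _ = _ - X](_ : _ = 0) ?subr0//.
  rewrite RintegralZl ?m_mean ?mulr0//.
  apply: (le_integrable_EFin (g := fun x => A * \1_PB x)).
  - by apply: measurable_funM => //; exact: measurable_indic.
  - by move=> x; rewrite normrM ger0_norm ?indicE// mulrC ler_wpM2r.
  by apply: integrable_cst_indic => //; exact: lebesgue_punctured_ball_lty.
have id : lam.-integrable setT (EFin \o
    (fun x => \1_PB x * (m x * J x) - c * (\1_PB x * m x))).
  exact: (integrableB measurableT ij im).
rewrite -lee_fin EFin_normr_Rintegral//.
have /integrableP[md _] := id.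
apply: (le_trans (le_abse_integral _ measurableT md)).
(* Here [y] has no unit direction, but [J] is constant and equal to [c]. *)
have [y0|y0] := eqVneq y 0.
  rewrite (eq_integral (cst 0%E)) ?integral0 ?lee_fin ?mulr_ge0// => x _ /=.
  rewrite /J /c (_ : dotr y (direction x) = enorm y).
    by rewrite [_ * (m x * _)]mulrA mulrC subrr normr0.
  rewrite y0 /dotr big1 => [|i _]; last by rewrite mxE mul0r.
  by apply/esym/eqP; rewrite enorm_eq0.
have yp : 0 < enorm y by rewrite enorm_gt0.
pose e := direction y.
have e1 : enorm e = 1 by exact: enorm_direction.
pose S (k : nat) : set 'rV[R]_n := slab 1 e 0 (expR (- k%:R)).
have mS k : measurable (S k) by exact: measurable_slab.
(* The number of slabs containing [x] may be infinite, namely where [<e, x> = 0], so the comparison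
   is made in the extended reals. *)
apply: (@le_trans _ _ (\int[lam]_x ((A * 2)%:E * \sum_(k <oo) (\1_(S k) x :
  R)%:E))%E).
  apply: ge0_le_integral => //.
  - exact: measurableT_comp.
  - apply: emeasurable_funM; first exact: measurable_cst.
    apply: ge0_emeasurable_sum => // k _.
    by apply/measurable_EFinP; exact: measurable_indic.
  move=> x _; rewrite [leLHS]/=.
  have s0 : (0 <= \sum_(k <oo) (\1_(S k) x : R)%:E)%E by exact: nneseries_ge0.
  have -> : \1_PB x * (m x * J x) - c * (\1_PB x * m x) = \1_PB x * (m x * (J x
    - c)).
    by ring.
  rewrite /= indicE; have [xB|xB] := boolP (x \in PB); last first.
    by rewrite mul0r normr0 mule_ge0// lee_fin mulr_ge0.
  move: xB; rewrite inE /punctured_ball/= => /andP[xp x1].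
  have x0 : x != 0 by rewrite -enorm_gt0.
  rewrite mul1r normrM EFinM EFinM -muleA lee_pmul ?lee_fin//.
  pose tau := dotr e (direction x).
  (* The slabs constrain [x] and not its direction, to remain linear conditions; since [|x| <= 1], a
     bound on [tau] passes to [<e, x>]. *)
  have etau : dotr e x = enorm x * tau by rewrite /tau -dotr_scaler directionK.
  have ytau : dotr y (direction x) = enorm y * tau.
    by rewrite /tau -dotr_scalel /e directionK.
  have tau1 : `|tau| <= 1.
    by rewrite (le_trans (normr_dotr _ _))// e1 enorm_direction// mulr1.
  (* [N] counts the integers from 0 to the integer part of [- ln |tau|], all of which satisfy
     [|tau| <= e^-k]. For [tau = 0] every [k] qualifies, and [N] is merely taken large enough to
     dominate [J x - c]. *)
  have [N vN HN] : exists2 N : nat, `|J x - c| <= 2 * N%:R &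
      forall k, (k < N)%N -> `|tau| <= expR (- k%:R).
    have [t0|t0] := eqVneq tau 0.
      exists (Num.truncn `|J x - c|).+1.
        by have := truncnS_gt `|J x - c|; have : 0 <= `|J x - c| by []; lra.
      by move=> k _; rewrite t0 normr0 expR_ge0.
    have tp : 0 < `|tau| <= 1 by rewrite normr_gt0 t0.
    have lt0 : 0 <= - ln `|tau| by rewrite oppr_ge0 -ln1 ler_ln ?posrE ?normr_gt0.
    exists (Num.truncn (- ln `|tau|)).+1.
      rewrite /J ytau (le_trans (normr_osc_cos _ l01 tp))// ler_wpM2l// ltW//.
      exact: truncnS_gt.
    move=> k; rewrite ltnS => kN; rewrite -[leLHS]lnK ?posrE ?normr_gt0// ler_expR.
    rewrite lerNr (@le_trans _ _ (Num.truncn (- ln `|tau|))%:R) ?ler_nat//.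
    by rewrite truncn_le.
  apply: (@le_trans _ _ (2%:E * N%:R%:E)%E); first by rewrite -EFinM lee_fin.
  rewrite lee_wpmul2l ?lee_fin//; apply: log_slabs_ge => // k kN.
  rewrite etau normrM (ger0_norm (ltW xp)) (le_trans _ (HN k kN))//.
  by rewrite ler_piMl.
have A2 : 0 <= A * 2 by rewrite mulr_ge0.
rewrite ge0_integralZl_EFin//; last first.
  apply: ge0_emeasurable_sum => // k _.
  by apply/measurable_EFinP; exact: measurable_indic.
  by move=> x _; exact: nneseries_ge0.
rewrite [X in (_ <= X)%E]EFinM lee_wpmul2l ?lee_fin//.
exact: integral_log_slabs.
Qed.

End kernel.

(** * From bounded kernels to bounded multipliers *)

Section convolution.
Variables (R : realType) (n : nat).
Local Notation lam := (lebesgue_rV R n).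
Variables (m : 'rV[R]_n -> R) (A : R).
Hypotheses (mm : measurable_fun setT m) (mA : forall x, `|m x| <= A).
Variables (h : R -> R) (eps rho : R).
Hypotheses (mh : measurable_fun setT h) (h1 : forall t, `|h t| <= 1).
Hypotheses (eps_gt0 : 0 < eps).
Variables (g : 'rV[R]_n -> R) (x : 'rV[R]_n).
Hypothesis ig : lam.-integrable setT (EFin \o g).

Let w xi := \1_(@annulus R n eps rho) xi * m xi / enorm xi ^+ n.

(** The truncation bounds [w] and confines it to a set of finite volume, so [F] is absolutely
    integrable on the product; the exchange of integrals below is made for [F]. *)
Let F (z : 'rV[R]_n * 'rV[R]_n) := w z.1 * (h (dotr (x - z.2) z.1) * g z.2).

Let A_ge0 : 0 <= A. Proof. exact: le_trans (mA 0). Qed.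

Let measurable_w : measurable_fun setT w.
Proof.
apply: measurable_funM.
  by apply: measurable_funM => //; apply: measurable_indic;
    exact: measurable_annulus.
exact: measurable_enormXV.
Qed.

Let measurable_g : measurable_fun setT g.
Proof. by move/integrableP : ig => [/measurable_EFinP]. Qed.

Let w_le xi : `|w xi| <= A * eps ^- n * \1_(@annulus R n eps rho) xi.
Proof.
rewrite /w indicE; have [xA|] := boolP (xi \in _);
  last by rewrite !mul0r normr0 mulr0.
rewrite mul1r mulr1 normrM.
move: xA; rewrite inE /annulus/= => /andP[H1 H2].
have xp : 0 < enorm xi by exact: lt_le_trans H1.
rewrite (ger0_norm (_ : 0 <= enorm xi ^- n)) ?invr_ge0 ?exprn_ge0 ?enorm_ge0//.
apply: ler_pM => //; first by rewrite invr_ge0 exprn_ge0// enorm_ge0.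
by rewrite lef_pV2 ?posrE ?exprn_gt0// lerXn2r ?nnegrE ?enorm_ge0// ltW.
Qed.

Let integrable_F : (lam \x lam)%E.-integrable setT (EFin \o F).
Proof.
apply: (le_integrable_EFin (g := fun z =>
    (A * eps ^- n * \1_(@annulus R n eps rho) z.1) * `|g z.2|)).
- apply: measurable_funM; first by apply: (measurableT_comp measurable_w);
    exact: measurable_fst.
  apply: measurable_funM; last by apply: (measurableT_comp measurable_g);
    exact: measurable_snd.
  apply: (measurableT_comp mh); apply: measurable_dotr; last exact: measurable_fst.
  apply: measurable_fun_rV => i; under eq_fun do rewrite !mxE.
  apply: measurable_funB => //.
  by apply: (measurableT_comp (measurable_coord i)); exact: measurable_snd.
- move=> z; rewrite /F normrM ler_pM//.
  by rewrite normrM ler_piMl.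
apply: (@integrable_prodM _ _ _ _ _ lam lam
    (fun xi => A * eps ^- n * \1_(@annulus R n eps rho) xi) (fun y => `|g y|)).
  apply: integrable_cst_indic; first exact: measurable_annulus.
  apply: (@lebesgue_sub_ball_lty _ _ rho); first exact: measurable_annulus.
  by move=> y /andP[].
exact: integrable_norm.
Qed.

Let integrable_phase xi :
  lam.-integrable setT (EFin \o (fun y => h (dotr (x - y) xi) * g y)).
Proof.
apply: (le_integrable_EFin (g := fun y => `|g y|)); last exact: integrable_norm.
  apply: measurable_funM => //; apply: (measurableT_comp mh).
  apply: measurable_dotr => //; apply: measurable_fun_rV => i.
  by under eq_fun do rewrite !mxE; apply: measurable_funB => //;
    exact: measurable_coord.
by move=> y; rewrite normrM ler_piMl.
Qed.

Let integrable_kernel y :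
  lam.-integrable setT (EFin \o (fun xi => \1_(@annulus R n eps rho) xi * m xi *
    h (dotr y xi) / enorm xi ^+ n)).
Proof.
under eq_fun do rewrite mulrAC.
apply: (le_integrable_EFin (g := fun xi => A * eps ^- n * \1_(@annulus R n eps
  rho) xi)).
- apply: measurable_funM => //.
  by apply: (measurableT_comp mh); exact: measurable_dotr.
- by move=> xi; rewrite normrM (le_trans _ (w_le xi))// ler_piMr.
apply: integrable_cst_indic; first exact: measurable_annulus.
apply: (@lebesgue_sub_ball_lty _ _ rho); first exact: measurable_annulus.
by move=> z /andP[].
Qed.

Definition multiplier_integrand xi : R :=
  \1_(@annulus R n eps rho) xi * m xi / enorm xi ^+ n *
  \int[lam]_y (h (dotr (x - y) xi) * g y).

Lemma integrable_multiplier : lam.-integrable setT (EFin \o multiplier_integrand).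
Proof.
apply: (eq_integrable measurableT (EFin \o (fun xi => \int[lam]_y F (xi, y))));
  last exact: integrable_Rintegral1.
by move=> xi _; rewrite /= /F /= RintegralZl.
Qed.

(** By Fubini the frequency integral may be carried out first; it produces the kernel at [x - y]. *)
Lemma multiplier_convolution : \int[lam]_xi multiplier_integrand xi =
  \int[lam]_y (g y * kernel m h eps rho (x - y)).
Proof.
transitivity (\int[lam]_xi \int[lam]_y F (xi, y)).
  by apply: eq_Rintegral => xi _; rewrite /F /= RintegralZl.
rewrite Rintegral_Fubini//; apply: eq_Rintegral => y _.
rewrite /kernel -RintegralZl//.
by apply: eq_Rintegral => xi _; rewrite /F /w/=; ring.
Qed.

Lemma normr_multiplier (C : R) : (forall y, `|kernel m h eps rho y| <= C) ->
  `|\int[lam]_xi multiplier_integrand xi| <= C * \int[lam]_y `|g y|.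
Proof.
move=> KC; rewrite multiplier_convolution -RintegralZl//;
  last exact: integrable_norm.
have iK : lam.-integrable setT (EFin \o (fun y => g y * kernel m h eps rho (x -
  y))).
  apply: (eq_integrable measurableT (EFin \o (fun y => \int[lam]_xi F (xi, y))));
    last exact: integrable_Rintegral2.
  move=> y _ /=; congr EFin; rewrite /kernel -RintegralZl//.
  by apply: eq_Rintegral => xi _; rewrite /F /w/=; ring.
have /integrableP[/measurable_EFinP mK _] := iK.
apply: ler_norm_Rintegral => //.
  by move=> y; rewrite normrM mulrC ler_wpM2r.
exact: (@integrableZl _ _ _ lam setT measurableT C _ (integrable_norm ig)).
Qed.

End convolution.

(** * Complex multipliers *)

Section multipliers.
Variables (R : realType) (n : nat) (n_gt0 : (0 < n)%N).
Local Notation lam := (lebesgue_rV R n).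
Local Open Scope complex_scope.

Definition wave (b : bool) (u : R) : R :=
  if b then cos (2 * pi * u) else sin (2 * pi * u).

Lemma measurable_wave b : measurable_fun setT (wave b).
Proof.
have m2 : measurable_fun setT (fun u : R => 2 * pi * u) by exact: measurable_funM.
by case: b; [apply: (measurableT_comp (continuous_measurable_fun
  (@continuous_cos R)))
            |apply: (measurableT_comp (continuous_measurable_fun
              (@continuous_sin R)))].
Qed.

Lemma normr_wave b u : `|wave b u| <= 1.
Proof. by case: b; [exact: cos_max|exact: sin_max]. Qed.

(** Since [m] is homogeneous of degree 0, the last condition says, up to the factor [n], that its
    integral over the sphere vanishes. *)
Definition mean_zero_multiplier (m : 'rV[R]_n -> R) : Prop :=
  [/\ measurable_fun setT m, exists A, forall x, `|m x| <= A,
      forall (s : R) (x : 'rV[R]_n), 0 < s -> m (s *: x) = m x &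
      \int[lam]_x (\1_(@punctured_ball R n) x * m x) = 0].

Lemma multiplier_bounded (m : 'rV[R]_n -> R) : mean_zero_multiplier m ->
  exists2 C : R, 0 <= C & forall (eps rho : R), 0 < eps -> eps <= rho ->
    forall (g : 'rV[R]_n -> R) (x : 'rV[R]_n) (b : bool),
    lam.-integrable setT (EFin \o g) ->
    lam.-integrable setT
      (EFin \o multiplier_integrand m (wave b) eps rho g x) /\
    `|\int[lam]_xi multiplier_integrand m (wave b) eps rho g x xi| <=
      C * \int[lam]_y `|g y|.
Proof.
move=> [mm [A mA] mh m0].
have [C1 HC1] := kernel_cos_bounded n_gt0 mm mA mh m0.
have [C2 HC2] := kernel_sin_bounded n_gt0 mm mA mh.
exists (Num.max `|C1| `|C2|); first by rewrite le_max normr_ge0.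
move=> eps rho e0 er g x b ig; split.
  exact: (integrable_multiplier mm mA rho (measurable_wave b) (normr_wave b) e0
    x ig).
apply: (normr_multiplier mm mA (measurable_wave b) (normr_wave b) e0 x ig) => y.
rewrite le_max; case: b.
  by apply/orP; left; exact: le_trans (HC1 _ _ y e0 er) (ler_norm _).
by apply/orP; right; exact: le_trans (HC2 _ _ y e0 er) (ler_norm _).
Qed.

Lemma ReM (a b : R[i]) :
  complex.Re (a * b) = complex.Re a * complex.Re b - complex.Im a * complex.Im b.
Proof. by case: a b => [? ?] [? ?]. Qed.

Lemma ImM (a b : R[i]) :
  complex.Im (a * b) = complex.Re a * complex.Im b + complex.Im a * complex.Re b.
Proof. by case: a b => [? ?] [? ?]. Qed.

Lemma ler_normBB (a b c d X Y Z W : R) : `|a| <= X -> `|b| <= Y ->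
  `|c| <= Z -> `|d| <= W -> `|a - b - (c + d)| <= X + Y + (Z + W).
Proof.
move=> aX bY cZ dW; apply: le_trans (ler_normB _ _) _; apply: lerD.
  by apply: le_trans (ler_normB _ _) _; exact: lerD.
by apply: le_trans (ler_normD _ _) _; exact: lerD.
Qed.

Lemma ler_normDB (a b c d X Y Z W : R) : `|a| <= X -> `|b| <= Y ->
  `|c| <= Z -> `|d| <= W -> `|a + b + (c - d)| <= X + Y + (Z + W).
Proof.
move=> aX bY cZ dW; apply: le_trans (ler_normD _ _) _; apply: lerD.
  by apply: le_trans (ler_normD _ _) _; exact: lerD.
by apply: le_trans (ler_normB _ _) _; exact: lerD.
Qed.

Section translated_transform.
Variables (g : 'rV[R]_n -> R[i]) (ig : cintegrable lam setT g).
Variables (x xi : 'rV[R]_n).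

Let u y := complex.Re (g y).
Let v y := complex.Im (g y).

Let iu : lam.-integrable setT (EFin \o u). Proof. by case: ig. Qed.
Let iv : lam.-integrable setT (EFin \o v). Proof. by case: ig. Qed.

Let I (b : bool) (f : 'rV[R]_n -> R) : R := \int[lam]_y (wave b (dotr y xi) * f y).

Let integrable_wave (b : bool) (f : 'rV[R]_n -> R) (c : R) :
  lam.-integrable setT (EFin \o f) ->
  lam.-integrable setT (EFin \o (fun y => c * (wave b (dotr y xi) * f y))).
Proof.
move=> fi; have /integrableP[/measurable_EFinP mf _] := fi.
apply: (@integrableZl _ _ _ lam setT measurableT c
  (EFin \o (fun y => wave b (dotr y xi) * f y))).
apply: (le_integrable_EFin (g := fun y => `|f y|)); last exact: integrable_norm.
  apply: measurable_funM => //; apply: (measurableT_comp (measurable_wave b)).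
  exact: measurable_dotr.
by move=> y; rewrite normrM ler_piMl// normr_wave.
Qed.

Let integrable_wave1 (b : bool) (f : 'rV[R]_n -> R) :
  lam.-integrable setT (EFin \o f) ->
  lam.-integrable setT (EFin \o (fun y => wave b (dotr y xi) * f y)).
Proof.
move=> /(integrable_wave b 1); congr (lam.-integrable _ (EFin \o _)).
by apply/funext => y; rewrite mul1r.
Qed.

Let a := dotr x xi.

Let wave_translate (b : bool) (f : 'rV[R]_n -> R) :
  lam.-integrable setT (EFin \o f) ->
  \int[lam]_y (wave b (dotr (x - y) xi) * f y) =
  wave b a * I true f + (if b then 1 else -1) * wave (~~ b) a * I false f.
Proof.
move=> fi; rewrite /I -!RintegralZl//.
- rewrite -RintegralD//; [|exact: integrable_wave..].
  apply: eq_Rintegral => y _; rewrite dotr_subl /wave /a mulrBr.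
  by case: b; rewrite /= ?cosB ?sinB; ring.
- exact: integrable_wave1.
- exact: integrable_wave1.
Qed.

(** The phases in [x] and in [y] combine into a single phase in [x - y]; separating cosines from
    sines leaves the real integrals that occur in [multiplier_integrand]. *)
Lemma cis_transform :
  cis (2 * pi * dotr x xi) *
    cintegral lam setT (fun y => cis (- (2 * pi * dotr y xi)) * g y) =
  (\int[lam]_y (wave true (dotr (x - y) xi) * u y) -
   \int[lam]_y (wave false (dotr (x - y) xi) * v y)) +i*
  (\int[lam]_y (wave true (dotr (x - y) xi) * v y) +
   \int[lam]_y (wave false (dotr (x - y) xi) * u y)).
Proof.
rewrite !wave_translate// /cintegral.
have -> : \int[lam]_y complex.Re (cis (- (2 * pi * dotr y xi)) * g y) =
    I true u + I false v.
  rewrite /I -RintegralD//.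
  - apply: eq_Rintegral => y _; rewrite ReM /= cosN sinN /u /v; ring.
  - exact: integrable_wave1.
  - exact: integrable_wave1.
have -> : \int[lam]_y complex.Im (cis (- (2 * pi * dotr y xi)) * g y) =
    I true v - I false u.
  rewrite /I -RintegralB//.
  - apply: eq_Rintegral => y _; rewrite ImM /= cosN sinN /u /v; ring.
  - exact: integrable_wave1.
  - exact: integrable_wave1.
apply/eqP; rewrite eq_complex ReM ImM /= /wave /a; apply/andP; split;
  apply/eqP; ring.
Qed.

End translated_transform.

Definition complex_integrand (m : 'rV[R]_n -> R[i]) (eps rho : R)
    (g : 'rV[R]_n -> R[i]) (x xi : 'rV[R]_n) : R[i] :=
  cis (2 * pi * dotr x xi) *
  ((\1_(@annulus R n eps rho) xi)%:C * (enorm xi ^- n)%:C *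
   (cintegral lam setT (fun y => cis (- (2 * pi * dotr y xi)) * g y) * m xi)).

(** Expanding the product of phase, [g] and [m], each of the two parts is a signed sum of four real
    multiplier integrals, two with the real part of [m] and two with the imaginary part; hence the
    constant [C1 + C2]. *)
Lemma complex_multiplier_bounded (m : 'rV[R]_n -> R[i]) :
  mean_zero_multiplier (fun x => complex.Re (m x)) ->
  mean_zero_multiplier (fun x => complex.Im (m x)) ->
  exists2 C : R, 0 <= C & forall (eps rho : R), 0 < eps -> eps <= rho ->
    forall (g : 'rV[R]_n -> R[i]) (x : 'rV[R]_n), cintegrable lam setT g ->
    let Phi := complex_integrand m eps rho g x in
    let N := \int[lam]_y `|complex.Re (g y)| + \int[lam]_y `|complex.Im (g y)| in
    [/\ cintegrable lam setT Phi,
        `|\int[lam]_xi complex.Re (Phi xi)| <= C * N &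
        `|\int[lam]_xi complex.Im (Phi xi)| <= C * N].
Proof.
move=> /multiplier_bounded[C1 C1_ge0 H1] /multiplier_bounded[C2 C2_ge0 H2].
exists (C1 + C2); first exact: addr_ge0.
move=> eps rho e0 er g x ig Phi N.
pose p y := complex.Re (m y); pose q y := complex.Im (m y).
have [iu iv] := ig.
pose P b f := multiplier_integrand p (wave b) eps rho f x.
pose Q b f := multiplier_integrand q (wave b) eps rho f x.
pose u y := complex.Re (g y); pose v y := complex.Im (g y).
have [iPcu nPcu] := H1 _ _ e0 er u x true iu.
have [iPsu nPsu] := H1 _ _ e0 er u x false iu.
have [iPcv nPcv] := H1 _ _ e0 er v x true iv.
have [iPsv nPsv] := H1 _ _ e0 er v x false iv.
have [iQcu nQcu] := H2 _ _ e0 er u x true iu.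
have [iQsu nQsu] := H2 _ _ e0 er u x false iu.
have [iQcv nQcv] := H2 _ _ e0 er v x true iv.
have [iQsv nQsv] := H2 _ _ e0 er v x false iv.
have PhiE xi : Phi xi = (\1_(@annulus R n eps rho) xi)%:C * (enorm xi ^- n)%:C *
    (cis (2 * pi * dotr x xi) *
     cintegral lam setT (fun y => cis (- (2 * pi * dotr y xi)) * g y) * m xi).
  by rewrite /Phi /complex_integrand mulrCA -!mulrA.
have RePhi xi : complex.Re (Phi xi) =
    P true u xi - P false v xi - (Q true v xi + Q false u xi).
  rewrite PhiE cis_transform// !(ReM, ImM) /= /P /Q /multiplier_integrand -/(p
    xi) -/(q xi).
  by rewrite /u /v; ring.
have ImPhi xi : complex.Im (Phi xi) =
    P true v xi + P false u xi + (Q true u xi - Q false v xi).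
  rewrite PhiE cis_transform// !(ReM, ImM) /= /P /Q /multiplier_integrand -/(p
    xi) -/(q xi).
  by rewrite /u /v; ring.
have iP1 := integrableB measurableT iPcu iPsv.
have iQ1 := integrableD measurableT iQcv iQsu.
have iP2 := integrableD measurableT iPcv iPsu.
have iQ2 := integrableB measurableT iQcu iQsv.
have Nu : 0 <= \int[lam]_y `|u y| by exact: Rintegral_ge0.
have Nv : 0 <= \int[lam]_y `|v y| by exact: Rintegral_ge0.
pose U := \int[lam]_y `|u y|; pose V := \int[lam]_y `|v y|.
have NE : (C1 + C2) * N = C1 * U + C1 * V + (C2 * V + C2 * U).
  by rewrite /N -/u -/v -/U -/V; ring.
split.
- split.
    apply: (eq_integrable measurableT (EFin \o (fun xi =>
      P true u xi - P false v xi - (Q true v xi + Q false u xi)))).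
      by move=> xi _; rewrite /= RePhi.
    exact: (integrableB measurableT iP1 iQ1).
  apply: (eq_integrable measurableT (EFin \o (fun xi =>
    P true v xi + P false u xi + (Q true u xi - Q false v xi)))).
    by move=> xi _; rewrite /= ImPhi.
  exact: (integrableD measurableT iP2 iQ2).
- under eq_Rintegral do rewrite RePhi.
  by rewrite RintegralB// RintegralB// RintegralD// NE;
    exact: (ler_normBB nPcu nPsv nQcv nQsu).
- under eq_Rintegral do rewrite ImPhi.
  rewrite RintegralD// RintegralD// RintegralB// NE [C1 * U + _]addrC [C2 * V +
    _]addrC.
  exact: (ler_normDB nPcv nPsu nQcu nQsv).
Qed.

End multipliers.

(** * Orthogonal projections *)

Section complex_norm.
Variable R : realType.
Implicit Types x y : R[i].

Lemma normc_ge0 x : 0 <= Normc.normc x.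
Proof. by case: x => a b; exact: sqrtr_ge0. Qed.

Lemma sqr_normc x : Normc.normc x ^+ 2 = complex.Re x ^+ 2 + complex.Im x ^+ 2.
Proof. by case: x => a b; rewrite /= sqr_sqrtr// addr_ge0// sqr_ge0. Qed.

Lemma ler_Re_normc x : `|complex.Re x| <= Normc.normc x.
Proof.
case: x => a b; rewrite /= -sqrtr_sqr; apply: ler_wsqrtr.
by rewrite lerDl sqr_ge0.
Qed.

Lemma ler_Im_normc x : `|complex.Im x| <= Normc.normc x.
Proof.
case: x => a b; rewrite /= -sqrtr_sqr; apply: ler_wsqrtr.
by rewrite lerDr sqr_ge0.
Qed.

Lemma normc_le x : Normc.normc x <= `|complex.Re x| + `|complex.Im x|.
Proof.
rewrite -[leRHS]ger0_norm ?addr_ge0// -sqrtr_sqr; case: x => a b /=.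
apply: ler_wsqrtr; rewrite sqrrD !real_normK ?num_real//.
by rewrite lerD2r lerDl mulrn_wge0// mulr_ge0.
Qed.

Lemma mulr_conj x : x * x^* = (Normc.normc x ^+ 2)%:C%C.
Proof.
rewrite sqr_normc; case: x => a b.
rewrite -[(_)^*]/(conjc _) /=; apply/eqP; rewrite eq_complex/= !mulrN opprK.
by rewrite !expr2 eqxx/= mulrC addrC subrr.
Qed.

Lemma hsnorm_ge0 (m n : nat) (A : 'M[R[i]]_(m, n)) : 0 <= hsnorm A.
Proof. exact: sqrtr_ge0. Qed.

Lemma ler_normc_hsnorm (m n : nat) (A : 'M[R[i]]_(m, n)) i j :
  Normc.normc (A i j) <= hsnorm A.
Proof.
rewrite -[leLHS]ger0_norm ?normc_ge0// -sqrtr_sqr; apply: ler_wsqrtr.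
rewrite (bigD1 i)//= (bigD1 j)//= -addrA lerDl addr_ge0//.
  by apply: sumr_ge0 => k _; rewrite sqr_ge0.
by apply: sumr_ge0 => k _; apply: sumr_ge0 => q _; rewrite sqr_ge0.
Qed.

Lemma hsnorm_row_le (m n : nat) (A : 'M[R[i]]_(m, n)) i :
  hsnorm (row i A) <= hsnorm A.
Proof.
apply: ler_wsqrtr; rewrite big_ord1 [leRHS](bigD1 i)//= -[leLHS]addr0 lerD//.
  by apply: ler_sum => j _; rewrite mxE.
by apply: sumr_ge0 => k _; apply: sumr_ge0 => q _; rewrite sqr_ge0.
Qed.

Lemma measurable_hsnorm d (T : measurableType d) (l : nat) (g : T -> 'rV[R[i]]_l) :
  (forall j, measurable_fun setT (fun t => complex.Re (g t 0 j))) ->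
  (forall j, measurable_fun setT (fun t => complex.Im (g t 0 j))) ->
  measurable_fun setT (fun t => hsnorm (g t)).
Proof.
move=> mRe mIm.
have msqrt : measurable_fun setT (@Num.sqrt R).
  by apply: continuous_measurable_fun; exact: sqrt_continuous.
apply: (measurableT_comp msqrt).
under eq_fun do rewrite big_ord1.
apply: measurable_sum => j; under eq_fun do rewrite sqr_normc.
by apply: measurable_funD; exact: measurable_funX.
Qed.

End complex_norm.

Section orthproj.
Variables (R : realType) (l : nat).
Implicit Types (L : {vspace 'rV[R[i]]_l}) (v : 'rV[R[i]]_l).
Local Open Scope sesquilinear_scope.

Let base L : 'M[R[i]]_(\dim L, l) := \matrix_(i < \dim L) tnth (vbasis L) i.

Let memv_base L v : (v \in L) = (v <= base L)%MS.
Proof.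
apply/idP/submxP => [vL|[D ->]].
  exists (\row_i coord (vbasis L) i v).
  rewrite {1}(coord_vbasis vL); apply/rowP => j.
  rewrite summxE !mxE; apply: eq_bigr => i _; rewrite !mxE.
  by rewrite (tnth_nth 0).
rewrite mulmx_sum_row; apply: memv_suml => i _; apply: memvZ.
by rewrite rowK; apply: vbasis_mem; exact: mem_tnth.
Qed.

Lemma memv_orthproj L v : v *m orthproj L \in L.
Proof. by rewrite memv_base; exact: proj_ortho_sub. Qed.

Lemma orthproj_id L v : v \in L -> v *m orthproj L = v.
Proof. by rewrite memv_base; exact: proj_ortho_id. Qed.

Lemma memv_orthprojP L v : reflect (v *m orthproj L = v) (v \in L).
Proof.
by apply: (iffP idP) => [|<-]; [exact: orthproj_id|exact: memv_orthproj].
Qed.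

(** Let [P'] be the conjugate transpose of [P]. The rows of [1 - P] are orthogonal to [L], which
    contains the rows of [P], so [P P' = P']. The left side is self-adjoint, hence [P' = P]. *)
Lemma orthproj_conjT L : (orthproj L)^t* = orthproj L.
Proof.
have /orthomx1P H := proj_ortho_compl_sub (base L) (1%:M : 'M[R[i]]_l).
have /submxP[D PD] := proj_ortho_sub (base L) (1%:M : 'M[R[i]]_l).
have PP : orthproj L *m (orthproj L)^t* = (orthproj L)^t*.
  apply/esym/eqP; rewrite -subr_eq0 -{1}[(orthproj L)^t*]mul1mx -mulmxBl.
  rewrite mul1mx in H; rewrite mul1mx in PD.
  rewrite /orthproj -/(base L) {2}PD trmx_mul map_mxM mulmxA.
  by rewrite H mul0mx.
have := congr1 (fun A : 'M[R[i]]_l => A^t*) PP.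
by rewrite trmx_mul map_mxM !(@trmxCK R[i]) PP.
Qed.

Lemma orthproj_idem L : orthproj L *m orthproj L = orthproj L.
Proof. exact: proj_ortho_proj. Qed.

Lemma mulmx_conjT_hsnorm (u : 'rV[R[i]]_l) :
  (u *m u^t*) 0 0 = (hsnorm u ^+ 2)%:C%C.
Proof.
rewrite mxE /hsnorm big_ord1 sqr_sqrtr; last first.
  by apply: sumr_ge0 => j _; rewrite sqr_ge0.
rewrite rmorph_sum/=; apply: eq_bigr => j _.
by rewrite !mxE mulr_conj.
Qed.

(** [1 - P] is a self-adjoint idempotent. The left side is linear in the projection, so it can be
    averaged over the sphere entry by entry; the right side shows that it is nonnegative. *)
Lemma mulmx_compl_orthproj L v :
  (v *m (1%:M - orthproj L) *m v^t*) 0 0 =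
  (hsnorm (v *m (1%:M - orthproj L)) ^+ 2)%:C%C.
Proof.
have QT : (1%:M - orthproj L)^t* = 1%:M - orthproj L.
  by rewrite raddfB/= map_mxB trmx1 map_mx1 orthproj_conjT.
have QQ : (1%:M - orthproj L) *m (1%:M - orthproj L) = 1%:M - orthproj L.
  by rewrite mulmxBl mul1mx mulmxBr mulmx1 orthproj_idem subrr subr0.
by rewrite -mulmx_conjT_hsnorm trmx_mul map_mxM QT mulmxA -[in RHS](mulmxA v) QQ.
Qed.

(** The diagonal entry at [j] equals [t^2], where [t] is the norm of row [j], because [P] is a
    self-adjoint idempotent. As an entry of that row it is also at most [t], so [t^2 <= t]. *)
Lemma hsnorm_row_orthproj L j : hsnorm (row j (orthproj L)) <= 1.
Proof.
have E : (orthproj L) j j = (hsnorm (row j (orthproj L)) ^+ 2)%:C%C.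
  rewrite -mulmx_conjT_hsnorm tr_row map_col -[X in _ *m col _ X]/((orthproj L)^t*).
  rewrite orthproj_conjT -{1}(orthproj_idem L) !mxE.
  by apply: eq_bigr => i _; rewrite !mxE.
have := ler_normc_hsnorm (row j (orthproj L)) 0 j.
rewrite mxE E /= expr0n/= addr0 sqrtr_sqr ger0_norm ?sqr_ge0//.
have := hsnorm_ge0 (row j (orthproj L)); set t := hsnorm _.
rewrite le_eqVlt => /predU1P[<-//|t0].
by rewrite expr2 ger_pMr.
Qed.

Lemma normc_orthproj L i j : Normc.normc (orthproj L i j) <= 1.
Proof.
apply: le_trans (hsnorm_row_orthproj L i).
by have := ler_normc_hsnorm (row i (orthproj L)) 0 j; rewrite mxE.
Qed.

End orthproj.

Section family.
Variables (R : realType) (d l : nat).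
Variable Omega : 'rV[R]_d -> {vspace 'rV[R[i]]_l}.
Variable B : forall z : 'rV[R]_d, {linear subvs_of (Omega z) -> R[i]}.

(* The coordinates of the functional [v |-> B z (pi_(Omega z) v)] on C^l. *)
Definition symbol (z : 'rV[R]_d) (j : 'I_l) : R[i] :=
  fun_of_family B z (row j (orthproj (Omega z))).

Lemma fun_of_familyE z (v : 'rV[R[i]]_l) : v \in Omega z ->
  fun_of_family B z v = \sum_j v 0 j * symbol z j.
Proof.
move=> vO; rewrite -{1}(orthproj_id vO) mulmx_sum_row /fun_of_family.
by rewrite !linear_sum; apply: eq_bigr => j _; rewrite !linearZ.
Qed.

End family.

(** * Means over the sphere *)

Section triangle.
Variables (R : realType) (n : nat).
Implicit Types x y : 'rV[R]_n.

Lemma enormN x : enorm (- x) = enorm x.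
Proof. by rewrite -scaleN1r enorm_scale normrN normr1 mul1r. Qed.

Lemma ler_enormD x y : enorm (x + y) <= enorm x + enorm y.
Proof.
rewrite -(ler_pXn2r (n := 2))// ?nnegrE ?addr_ge0 ?enorm_ge0//.
have E : dotr (x + y) (x + y) = dotr x x + dotr x y *+ 2 + dotr y y.
  rewrite /dotr -sumrMnl -!big_split/=; apply: eq_bigr => i _; rewrite !mxE; ring.
rewrite sqrrD !sqr_enorm E lerD2r lerD2l lerMn2r/=.
by rewrite (le_trans (ler_norm _))// normr_dotr.
Qed.

End triangle.

Section sphere_continuity.
Variables (R : realType) (n : nat).
Implicit Types f : 'rV[R]_n -> R.

Definition sphere_continuous f : Prop :=
  forall z, sphere n z -> forall eta, 0 < eta -> exists2 delta, 0 < delta &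
    forall w, sphere n w -> enorm (z - w) <= delta -> `|f z - f w| <= eta.

Let cell (k : nat) (x : 'rV[R]_n) : 'rV[int]_n := \row_i Num.floor (2 ^+ k * x 0 i).

Let measurable_cell k (c : 'rV[int]_n) : measurable (cell k @^-1` [set c]).
Proof.
have -> : cell k @^-1` [set c] = \bigcap_(i in [set: 'I_n])
    ((fun x : 'rV[R]_n => 2 ^+ k * x 0 i) @^-1`
      `[(c 0 i)%:~R, (c 0 i + 1)%:~R[%classic).
  apply/seteqP; split => x /=.
    by move=> <- i _ /=; rewrite in_itv/= !mxE floor_itv.
  move=> xc; apply/rowP => i; rewrite mxE; have := xc i I; rewrite /= in_itv/= => H.
  by apply/eqP; rewrite floor_eq.
apply: fin_bigcap_measurable => // i _.
rewrite -[X in measurable X]setTI; apply: measurable_funM => //.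
exact: measurable_coord.
Qed.

(** Preimages are countable unions of cells, whatever [h] is. *)
Let measurable_fun_cell k (h : 'rV[int]_n -> R) : measurable_fun setT (h \o cell k).
Proof.
move=> _ Y mY; rewrite setTI.
have -> : (h \o cell k) @^-1` Y = \bigcup_(c in h @^-1` Y) (cell k @^-1` [set c]).
  apply/seteqP; split => [x xY|x [c cY /= xc]]; first by exists (cell k x).
  by rewrite /= xc.
rewrite bigcup_mkcond; apply: countable_bigcupT_measurable; first exact: countableP.
by move=> c; case: ifP => // _; exact: measurable_cell.
Qed.

Let cell_close k x y i : cell k x = cell k y -> `|x 0 i - y 0 i| <= (2 ^+ k)^-1.
Proof.
move=> /rowP/(_ i); rewrite !mxE => E.
have k0 : 0 < 2 ^+ k :> R by rewrite exprn_gt0.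
rewrite -(ler_pM2l k0) divff ?gt_eqF// -[X in X * _]gtr0_norm// -normrM mulrBr.
have /andP[a1 a2] := floor_itv (2 ^+ k * x 0 i).
have /andP[b1 b2] := floor_itv (2 ^+ k * y 0 i).
rewrite E in a1 a2; rewrite !intrD in a2 b2; rewrite ler_norml; lra.
Qed.

(* [f] is the pointwise limit of functions that are constant on the dyadic cells
   of side [2^-k]. *)
Lemma measurable_sphere_continuous f : sphere_continuous f ->
  measurable_fun (sphere n) f.
Proof.
move=> cf.
(* A point of the sphere is chosen in each cell that meets it, and [f] is sampled there; the other
   cells get 0. *)
pose h (k : nat) (c : 'rV[int]_n) : R :=
  if pselect (exists z, sphere n z /\ cell k z = c) is left P
  then f (projT1 (cid P)) else 0.
apply: (@measurable_fun_cvg _ _ _ (sphere n) (fun k => h k \o cell k)).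
  by move=> k; apply: measurable_funTS; exact: measurable_fun_cell.
move=> z zS; apply/cvgrPdist_le => eta eta0.
have [delta delta0 H] := cf z zS eta eta0.
near=> k; rewrite /= /h; case: pselect => [P|]; last by case; exists z.
case: cid => w [/= wS wz]; apply: H => //.
apply: le_trans (ler_enorm_sum _) _.
apply: (@le_trans _ _ (\sum_(i < n) (2 ^+ k)^-1)).
  by apply: ler_sum => i _; rewrite !mxE; apply: cell_close.
(* The distance is at most [n / 2^k], and [k < 2^k], so [k >= n / delta] suffices. *)
rewrite sumr_const card_ord -[X in X <= _]mulr_natl ler_pdivrMr ?exprn_gt0//.
rewrite mulrC -ler_pdivrMr//; apply: le_trans (_ : k%:R <= _); last first.
  by rewrite -natrX ler_nat ltnW// ltn_expl.
near: k; exact: nbhs_infty_ger.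
Unshelve. all: by end_near. Qed.

End sphere_continuity.

(** * Integrals over the sphere as integrals over the punctured ball *)

Section ball_mean.
Variables (R : realType) (n : nat) (n_gt0 : (0 < n)%N).
Local Notation lam := (lebesgue_rV R n).
Local Notation PB := (@punctured_ball R n).
Implicit Types (f g : 'rV[R]_n -> R).

Lemma measurable_sphere : measurable (@sphere R n).
Proof.
have -> : sphere n = @enorm R n @^-1` [set 1] by [].
by rewrite -[X in measurable X]setTI; exact: measurable_enorm.
Qed.

Lemma sphere_direction (x : 'rV[R]_n) : x != 0 -> sphere n (direction x).
Proof. exact: enorm_direction. Qed.

Lemma punctured_ball_neq0 (x : 'rV[R]_n) : x \in PB -> x != 0.
Proof. by rewrite inE /punctured_ball/= -enorm_gt0 => /andP[]. Qed.

(** Not normalised: by [Rintegral_surface] it is [1 / n] times the integral over the sphere. *)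
Definition ball_mean f : R := \int[lam]_x (\1_PB x * f (direction x)).

Definition sphere_bounded f : Prop := exists A, forall z, sphere n z -> `|f z| <= A.

Definition tame f : Prop := sphere_continuous f /\ sphere_bounded f.

(** [f] is controlled on the sphere only, so it is set to 0 elsewhere; after composition with
    [direction] this affects the origin alone. *)
Lemma measurable_extension f : tame f ->
  measurable_fun setT ((f \_ (sphere n)) \o @direction R n).
Proof.
move=> [cf _].
have mf : measurable_fun setT (f \_ (sphere n)).
  exact: (iffLR (measurable_restrictT f measurable_sphere)
    (measurable_sphere_continuous cf)).
by apply: (measurableT_comp mf); exact: measurable_direction.
Qed.

Lemma ball_extension f x :
  \1_PB x * f (direction x) = \1_PB x * (f \_ (sphere n)) (direction x).
Proof.
rewrite indicE; have [xB|_] := boolP (x \in PB); last by rewrite !mul0r.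
by rewrite patchE mem_set//; apply: sphere_direction; exact: punctured_ball_neq0.
Qed.

Lemma integrable_ball f : tame f ->
  lam.-integrable setT (EFin \o (fun x => \1_PB x * f (direction x))).
Proof.
move=> tf; have [_ [A fA]] := tf.
apply: (le_integrable_EFin (g := fun x => `|A| * \1_PB x)).
- rewrite (_ : (fun x => _) = (fun x => \1_PB x * ((f \_ (sphere n)) \o
    @direction R n) x)).
    apply: measurable_funM; last exact: measurable_extension.
    by apply: measurable_indic; exact: measurable_punctured_ball.
  by apply/funext => x; exact: ball_extension.
- move=> x; rewrite indicE; have [xB|_] := boolP (x \in PB);
    last by rewrite mul0r normr0 mulr0.
  rewrite mul1r mulr1 (le_trans _ (ler_norm _))//; apply: fA.
  by apply: sphere_direction; exact: punctured_ball_neq0.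
apply: integrable_cst_indic; first exact: measurable_punctured_ball.
exact: lebesgue_punctured_ball_lty.
Qed.

Lemma tameD f g : tame f -> tame g -> tame (fun z => f z + g z).
Proof.
move=> [cf [A fA]] [cg [B gB]]; split.
  move=> z zS eta eta0; have e2 : 0 < eta / 2 by rewrite divr_gt0.
  have [d1 d10 H1] := cf z zS _ e2; have [d2 d20 H2] := cg z zS _ e2.
  exists (Num.min d1 d2); first by rewrite lt_min d10.
  move=> w wS; rewrite le_min => /andP[/(H1 _ wS) h1 /(H2 _ wS) h2].
  rewrite opprD addrACA (le_trans (ler_normD _ _))//; lra.
exists (A + B) => z zS; rewrite (le_trans (ler_normD _ _))//.
by apply: lerD; [exact: fA|exact: gB].
Qed.

Lemma tameZ (c : R) f : tame f -> tame (fun z => c * f z).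
Proof.
move=> [cf [A fA]]; split.
  move=> z zS eta eta0.
  have c0 : 0 < `|c| + 1 by rewrite ltr_wpDl.
  have [d1 d10 H1] := cf z zS _ (divr_gt0 eta0 c0).
  exists d1 => // w wS /(H1 _ wS); rewrite ler_pdivlMr// => h.
  by rewrite -mulrBr normrM; apply: le_trans h; rewrite mulrC ler_wpM2l// lerDl.
exists (`|c| * A) => z zS; rewrite normrM ler_wpM2l//; exact: fA.
Qed.

Lemma tame_cst (c : R) : tame (fun=> c).
Proof.
split; last by exists `|c|.
by move=> z _ eta eta0; exists 1 => // w _ _; rewrite subrr normr0 ltW.
Qed.

Lemma eq_ball_mean f g : (forall z, sphere n z -> f z = g z) ->
  ball_mean f = ball_mean g.
Proof.
move=> fg; apply: eq_Rintegral => x _; rewrite indicE.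
have [xB|_] := boolP (x \in PB); last by rewrite !mul0r.
by rewrite fg//; apply: sphere_direction; exact: punctured_ball_neq0.
Qed.

Lemma ball_meanD f g : tame f -> tame g ->
  ball_mean (fun z => f z + g z) = ball_mean f + ball_mean g.
Proof.
move=> tf tg; rewrite /ball_mean -RintegralD//; [|exact: integrable_ball..].
by apply: eq_Rintegral => x _; rewrite mulrDr.
Qed.

Lemma ball_meanZ (c : R) f : tame f ->
  ball_mean (fun z => c * f z) = c * ball_mean f.
Proof.
move=> tf; rewrite /ball_mean -RintegralZl//; last exact: integrable_ball.
by apply: eq_Rintegral => x _; rewrite mulrCA.
Qed.

Lemma ball_mean0 : ball_mean (fun=> 0) = 0.
Proof.
rewrite /ball_mean; under eq_Rintegral do rewrite mulr0.
by rewrite Rintegral_cst// mul0r.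
Qed.

Lemma mean_zero_extension f : tame f -> ball_mean f = 0 ->
  mean_zero_multiplier ((f \_ (sphere n)) \o @direction R n).
Proof.
move=> tf f0; have [_ [A fA]] := tf; split.
- exact: measurable_extension.
- exists `|A| => x; rewrite /= patchE; case: ifPn; last by rewrite normr0.
  by rewrite inE => /fA/le_trans; apply; exact: ler_norm.
- by move=> s x s0; rewrite /= direction_scale.
by rewrite -f0; apply: eq_Rintegral => x _; rewrite [RHS]ball_extension.
Qed.

(** Here [|x| >= 1 / 4], while [|x| z - x = (|x| - 1/2) z - (x - z/2)] has norm at most [2 s];
    dividing by [|x|] gives the factor 8. *)
Lemma direction_near (z x : 'rV[R]_n) (s : R) : sphere n z -> s <= 1 / 4 ->
  enorm (x - 2^-1 *: z) <= s ->
  x \in PB /\ enorm (z - direction x) <= 8 * s.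
Proof.
move=> /= z1 s4 xs.
have hz : enorm (2^-1 *: z) = 2^-1 by rewrite enorm_scale z1 mulr1 ger0_norm.
have x1 : enorm x <= s + 1 / 2.
  rewrite -[x](subrK (2^-1 *: z)) (le_trans (ler_enormD _ _))// hz; lra.
have x2 : 1 / 2 - s <= enorm x.
  have : enorm (2^-1 *: z) <= enorm x + enorm (x - 2^-1 *: z).
    rewrite -[enorm (x - _)]enormN -{1}[2^-1 *: z](subrKC x) (le_trans
      (ler_enormD _ _))// opprB; lra.
  rewrite hz; lra.
have xp : 0 < enorm x by lra.
split; first by rewrite inE /punctured_ball/= xp; lra.
have x0 : x != 0 by rewrite -enorm_gt0.
rewrite -(ler_pM2l xp) -[X in X * _]gtr0_norm// -enorm_scale scalerBr directionK//.
have -> : enorm x *: z - x = (enorm x - 2^-1) *: z - (x - 2^-1 *: z).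
  by rewrite scalerBl opprB addrA subrK.
rewrite (le_trans (ler_enormD _ _))// enormN enorm_scale z1 mulr1.
have : `|enorm x - 2^-1| <= s by rewrite ler_norml; lra.
have s0 : 0 <= s by rewrite (le_trans _ xs)// enorm_ge0.
have := mulr_ge0 s0 (_ : 0 <= enorm x - 4^-1); nra.
Qed.

(** If [f z > 0], continuity gives [f >= f z / 2] near [z], hence at the directions of all points of
    a small cube centred at [z / 2], whose volume is positive. *)
Lemma ball_mean_eq0 f : tame f -> (forall z, sphere n z -> 0 <= f z) ->
  ball_mean f = 0 -> forall z, sphere n z -> f z = 0.
Proof.
move=> tf f0 mf z zS; apply/eqP; rewrite eq_le f0// andbT leNgt; apply/negP => fz.
have [cf _] := tf.
have [delta delta0 H] := cf z zS _ (divr_gt0 fz (ltr0n R 2)).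
(* [1 / 4] is the range of [direction_near], and [delta / 8] keeps directions within [delta] of [z].
   The cube of half-side [s / n] lies in the ball of radius [s]. *)
pose s := Num.min (1 / 4) (delta / 8).
have s0 : 0 < s by rewrite lt_min !divr_gt0.
have s4 : s <= 1 / 4 by rewrite ge_min lexx.
have s8 : 8 * s <= delta.
  by rewrite mulrC -ler_pdivlMr// ge_min lexx orbT.
pose r := s / n%:R.
have n0 : 0 < n%:R :> R by rewrite ltr0n.
have r0 : 0 < r by rewrite divr_gt0.
pose Q := box (2^-1 *: z) r.
have mQ : measurable Q by exact: measurable_box.
have lQ : lam Q = ((2 * r) ^+ n)%:E by apply: lebesgue_box; exact: ltW.
have : 0 < ball_mean f; last by rewrite mf ltxx.
have Qoo : (lam Q < +oo)%E by rewrite lQ ltry.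
apply: (@lt_le_trans _ _ (\int[lam]_x (f z / 2 * \1_Q x))).
  rewrite Rintegral_cst_indic// [X in _ * fine X]lQ/= mulr_gt0 ?divr_gt0//.
  by rewrite exprn_gt0// mulr_gt0.
apply: le_Rintegral => //; [exact: integrable_cst_indic|exact: integrable_ball|].
move=> x _; rewrite indicE; have [xQ|_] := boolP (x \in Q); last first.
  rewrite mulr0 indicE; have [xB|_] := boolP (x \in PB); last by rewrite mul0r.
  by rewrite mul1r f0//; apply: sphere_direction; exact: punctured_ball_neq0.
have xz : enorm (x - 2^-1 *: z) <= s.
  rewrite (le_trans (ler_enorm_sum _))//.
  apply: (@le_trans _ _ (\sum_(i < n) r)).
    by apply: ler_sum => i _; move: xQ; rewrite inE => /(_ i); rewrite !mxE.
  by rewrite sumr_const card_ord -[X in X <= _]mulr_natr /r divfK// gt_eqF.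
have [xB dx] := direction_near zS s4 xz.
rewrite indicE xB mul1r mulr1.
have := H (direction x) (sphere_direction (punctured_ball_neq0 xB)) (le_trans
  dx s8).
by rewrite ler_norml; lra.
Qed.

Lemma ge0_integral_surface (f : 'rV[R]_n -> \bar R) : measurable_fun setT f ->
  (forall x, 0 <= f x)%E ->
  (\int[surface_measure R n]_(z in sphere n) f z =
   n%:R%:E * \int[lam]_(x in PB) f (direction x))%E.
Proof.
move=> mf f0.
have mPB := @measurable_punctured_ball R n.
have mS := measurable_sphere.
have mfS : measurable_fun (sphere n) f by exact: measurable_funTS.
pose nu := mrestr lam mPB.
pose sg := measure_function_pushforward__canonical__measure_function_Measure
  nu (@measurable_direction R n).
rewrite (eq_measure_integral (mscale n%:R%:nng sg)); last by [].
rewrite ge0_integral_mscale//=; congr (_ * _)%E.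
rewrite ge0_integral_pushforward//; last exact: measurable_direction.
(* The measure [nu] is carried by the punctured ball, which [D] contains; the rest of [D] is null
   for it. *)
pose D : set 'rV[R]_n := @direction R n @^-1` sphere n.
have mD : measurable D.
  by rewrite -[X in measurable X]setTI; exact: measurable_direction.
have mfd : measurable_fun setT (f \o @direction R n).
  by apply: (measurableT_comp mf); exact: measurable_direction.
have PBD : PB `<=` D.
  by move=> x xB; apply: sphere_direction; apply: punctured_ball_neq0; rewrite inE.
rewrite -/D -(setDUK PBD) ge0_integral_setU//; last 4 first.
- exact: measurableD.
- exact: measurable_funTS.
- by move=> x _; exact: f0.
- by rewrite disj_set2E setDIK.
rewrite [X in (_ + X)%E](_ : _ = 0%E) ?adde0.
  by apply: eq_measure_integral => A mA AB; rewrite /= /mrestr setIidl.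
apply: null_set_integral; first exact: measurableD.
  exact: measurable_funTS.
by rewrite /= /mrestr setDE -setIA setICl setI0 measure0.
Qed.

Lemma Rintegral_surface f : tame f ->
  \int[surface_measure R n]_(z in sphere n) f z = n%:R * ball_mean f.
Proof.
move=> tf; pose F := f \_ (sphere n).
have mF : measurable_fun setT (EFin \o F).
  apply/measurable_EFinP; have [cf _] := tf.
  exact: (iffLR (measurable_restrictT f measurable_sphere)
    (measurable_sphere_continuous cf)).
rewrite /Rintegral (eq_integral (EFin \o F)); last first.
  by move=> z zS; rewrite /F /= patchE zS.
rewrite integralE !ge0_integral_surface//;
  [|exact: measurable_funeneg|exact: measurable_funepos].
rewrite -[X in (_ * X - _)%E]/(\int[lam]_(x in PB) ((EFin \o F)^\+ \o
  @direction R n) x)%E.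
rewrite -[X in (_ - _ * X)%E]/(\int[lam]_(x in PB) ((EFin \o F)^\- \o
  @direction R n) x)%E.
rewrite -funepos_comp -funeneg_comp.
have -> : ball_mean f = fine (\int[lam]_(x in PB) (EFin \o F \o @direction R n)
  x)%E.
  rewrite /ball_mean -Rintegral_indic /Rintegral; congr fine.
  apply: eq_integral => x xB; rewrite /F/= patchE mem_set//.
  by apply: sphere_direction; exact: punctured_ball_neq0.
rewrite [in RHS]integralE.
have n0 : (0 < n%:R%:E :> \bar R)%E by rewrite lte_fin ltr0n.
set u := (\int[_]_(x in _) _^\+%E x)%E; set v := (\int[_]_(x in _) _^\-%E x)%E.
have u0 : (0 <= u)%E by exact: integral_ge0.
have v0 : (0 <= v)%E by exact: integral_ge0.
move: u v u0 v0 => [u| |] [v| |] //= u0 v0.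
- by rewrite mulrBr.
- by rewrite gt0_muley//= mulr0.
- by rewrite gt0_muley//= mulr0.
- by rewrite gt0_muley//= mulr0.
Qed.

End ball_mean.

(** * Complex-valued symbols *)

Section complex_tame.
Variables (R : realType) (n : nat).
Local Notation lam := (lebesgue_rV R n).
Implicit Types f g : 'rV[R]_n -> R[i].

Definition ctame f : Prop :=
  tame (fun z => complex.Re (f z)) /\ tame (fun z => complex.Im (f z)).

Definition cmean f : R[i] :=
  Complex (ball_mean (fun z => complex.Re (f z))) (ball_mean (fun z =>
    complex.Im (f z))).

Lemma eq_tame (f g : 'rV[R]_n -> R) : f =1 g -> tame f -> tame g.
Proof. by move=> /funext ->. Qed.

Lemma ReD (x y : R[i]) : complex.Re (x + y) = complex.Re x + complex.Re y.
Proof. by case: x y => [? ?] [? ?]. Qed.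

Lemma ImD (x y : R[i]) : complex.Im (x + y) = complex.Im x + complex.Im y.
Proof. by case: x y => [? ?] [? ?]. Qed.

Lemma eq_cmean f g : (forall z, sphere n z -> f z = g z) -> cmean f = cmean g.
Proof.
by move=> fg; congr Complex; apply: eq_ball_mean => z zS; rewrite fg.
Qed.

Lemma ctameD f g : ctame f -> ctame g -> ctame (fun z => f z + g z).
Proof.
move=> [fr fi] [gr gi]; split.
  by apply: eq_tame (tameD fr gr) => z; rewrite ReD.
by apply: eq_tame (tameD fi gi) => z; rewrite ImD.
Qed.

Lemma ctameZ (c : R[i]) f : ctame f -> ctame (fun z => c * f z).
Proof.
move=> [fr fi]; split.
  apply: eq_tame (tameD (tameZ (complex.Re c) fr) (tameZ (- complex.Im c) fi)) => z.
  by rewrite ReM mulNr.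
apply: eq_tame (tameD (tameZ (complex.Re c) fi) (tameZ (complex.Im c) fr)) => z.
by rewrite ImM.
Qed.

Lemma ctame_cst (c : R[i]) : ctame (fun=> c).
Proof. by split; exact: tame_cst. Qed.

Lemma cmeanD f g : ctame f -> ctame g ->
  cmean (fun z => f z + g z) = cmean f + cmean g.
Proof.
move=> [fr fi] [gr gi]; apply/eqP; rewrite eq_complex ReD ImD /=.
apply/andP; split; apply/eqP.
  by rewrite -ball_meanD//; congr ball_mean; apply/funext => z; rewrite ReD.
by rewrite -ball_meanD//; congr ball_mean; apply/funext => z; rewrite ImD.
Qed.

Lemma cmeanZ (c : R[i]) f : ctame f -> cmean (fun z => c * f z) = c * cmean f.
Proof.
move=> [fr fi]; apply/eqP; rewrite eq_complex ReM ImM /=.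
apply/andP; split; apply/eqP.
  rewrite -mulNr -!ball_meanZ// -ball_meanD//; [|exact: tameZ..].
  by congr ball_mean; apply/funext => z; rewrite ReM mulNr.
rewrite -!ball_meanZ// -ball_meanD//; [|exact: tameZ..].
by congr ball_mean; apply/funext => z; rewrite ImM.
Qed.

(** The two claims are proved together, since additivity of the mean requires the partial sums to be
    tame. *)
Lemma ctame_cmean_sum (I : Type) (s : seq I) (F : I -> 'rV[R]_n -> R[i]) :
  (forall i, ctame (F i)) ->
  ctame (fun z => \sum_(i <- s) F i z) /\
  cmean (fun z => \sum_(i <- s) F i z) = \sum_(i <- s) cmean (F i).
Proof.
move=> tF; elim: s => [|i s [IH1 IH2]].
  split.
    have -> : (fun z => \sum_(i <- [::]) F i z) = fun=> 0.
      by apply/funext => z; rewrite big_nil.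
    exact: ctame_cst.
  rewrite big_nil (@eq_cmean _ (fun=> 0)); last by move=> z _; rewrite big_nil.
  by apply/eqP; rewrite eq_complex/= !ball_mean0 eqxx.
have E : (fun z => \sum_(j <- i :: s) F j z) = (fun z => F i z + \sum_(j <- s)
  F j z).
  by apply/funext => z; rewrite big_cons.
by rewrite E big_cons cmeanD// IH2; split => //; exact: ctameD.
Qed.

(** The extension from the sphere that is homogeneous of degree 0, with value 0 at the origin. *)
Definition cextension f (x : 'rV[R]_n) : R[i] :=
  Complex (((fun z => complex.Re (f z)) \_ (sphere n)) (direction x))
          (((fun z => complex.Im (f z)) \_ (sphere n)) (direction x)).

Lemma cextensionE f x : x != 0 -> cextension f x = f (direction x).
Proof.
move=> /sphere_direction xS; rewrite /cextension !patchE mem_set//=.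
by case: (f _).
Qed.

Lemma cextension_bounded (n_gt0 : (0 < n)%N) f : ctame f -> cmean f = 0 ->
  exists2 C : R, 0 <= C & forall (eps rho : R), 0 < eps -> eps <= rho ->
    forall (g : 'rV[R]_n -> R[i]) (x : 'rV[R]_n), cintegrable lam setT g ->
    let Phi := complex_integrand (cextension f) eps rho g x in
    let N := \int[lam]_y `|complex.Re (g y)| + \int[lam]_y `|complex.Im (g y)| in
    [/\ cintegrable lam setT Phi,
        `|\int[lam]_xi complex.Re (Phi xi)| <= C * N &
        `|\int[lam]_xi complex.Im (Phi xi)| <= C * N].
Proof.
move=> [tr ti] /eqP; rewrite eq_complex/= => /andP[/eqP fr /eqP fi].
by apply: complex_multiplier_bounded => //; exact: mean_zero_extension.
Qed.

Lemma Rintegral_sum (I : Type) (s : seq I) (F : I -> 'rV[R]_n -> R) :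
  (forall i, lam.-integrable setT (EFin \o F i)) ->
  lam.-integrable setT (EFin \o (fun x => \sum_(i <- s) F i x)) /\
  \int[lam]_x (\sum_(i <- s) F i x) = \sum_(i <- s) \int[lam]_x F i x.
Proof.
move=> iF; elim: s => [|i s [IH1 IH2]].
  have -> : (fun x => \sum_(i <- [::]) F i x) = fun=> 0.
    by apply/funext => z; rewrite big_nil.
  by split; [exact: integrable0|rewrite Rintegral_cst// mul0r big_nil].
have -> : (fun x => \sum_(j <- i :: s) F j x) = (fun x => F i x + \sum_(j <- s)
  F j x).
  by apply/funext => z; rewrite big_cons.
rewrite RintegralD// IH2 big_cons; split => //.
exact: (integrableD measurableT (iF i) IH1).
Qed.

End complex_tame.

(** A finite-dimensional Fredholm alternative: what the left kernel of [M] annihilates lies in the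
    column space. The hypothesis is applied to the rows of the transposed cokernel matrix of the
    transpose of [M]. *)
Lemma exists_mulmx_of_ker (F : fieldType) (p : nat) (M : 'M[F]_p) (a : 'cV[F]_p) :
  (forall v : 'rV_p, v *m M = 0 -> v *m a = 0) -> exists w : 'cV_p, a = M *m w.
Proof.
move=> H; have H' (N : 'M[F]_p) : N *m M = 0 -> N *m a = 0.
  move=> NM; apply/row_matrixP => i; rewrite row_mul row0 H//.
  by rewrite -row_mul NM row0.
have : (a^T <= M^T)%MS.
  rewrite submxE; apply/eqP/trmx_inj; rewrite trmx_mul trmxK trmx0.
  by apply: H'; apply: trmx_inj; rewrite trmx_mul trmxK mulmx_coker trmx0.
by move=> /submxP[D aD]; exists D^T; rewrite -[M]trmxK -trmx_mul -aD trmxK.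
Qed.

(** [C] may be 0 or negative, hence [|C| + 1]. The bound [delta <= 1] keeps to the distances at
    which [holder] gives information. *)
Lemma holder_small (R : realType) (alpha C eta : R) : 0 < alpha -> 0 < eta ->
  exists2 delta, 0 < delta <= 1 &
    forall t, 0 <= t -> t <= delta -> C * t `^ alpha <= eta.
Proof.
move=> a0 e0; have c0 : 0 < `|C| + 1 by rewrite ltr_wpDl.
pose q := eta / (`|C| + 1); have q0 : 0 < q by rewrite divr_gt0.
exists (Num.min 1 (q `^ alpha^-1)).
  by rewrite lt_min ltr01 powR_gt0// ge_min lexx.
move=> t t0; rewrite le_min => /andP[_ tq].
have tqa : t `^ alpha <= q.
  have -> : q = (q `^ alpha^-1) `^ alpha.
    by rewrite -powRrM mulVf ?gt_eqF// powRr1// ltW.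
  by apply: ge0_ler_powR; rewrite ?nnegrE ?powR_ge0// ltW.
rewrite (le_trans (ler_norm _))// normrM (ger0_norm (powR_ge0 _ _)).
apply: (@le_trans _ _ ((`|C| + 1) * q)).
  by apply: ler_pM => //; [exact: powR_ge0|rewrite lerDl].
by rewrite /q mulrC divfK// gt_eqF.
Qed.

(** * The weakly canceling operator *)

Section weakly_canceling_operator.
Variables (R : realType) (d l : nat) (d_gt0 : (0 < d)%N).
Local Notation lam := (lebesgue_rV R d).
Variable Omega : 'rV[R]_d -> {vspace 'rV[R[i]]_l}.
Variable B : forall z : 'rV[R]_d, {linear subvs_of (Omega z) -> R[i]}.
Hypotheses (Omega_holder : holder_subspaces Omega) (B_holder : holder_family B)
  (B_canceling : weakly_canceling B).
Local Open Scope sesquilinear_scope.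

Let P z := orthproj (Omega z).
Let Q z : 'M[R[i]]_l := 1%:M - P z.

Let P_continuous z eta : sphere d z -> 0 < eta -> exists2 delta, 0 < delta <= 1 &
  forall w, sphere d w -> enorm (z - w) <= delta -> hsnorm (P z - P w) <= eta.
Proof.
move=> zS eta0; have [alpha [C [alpha0 H]]] := Omega_holder.
have [delta /andP[delta0 delta1] Hd] := holder_small C alpha0 eta0.
exists delta; first by rewrite delta0.
move=> w wS zw; apply: le_trans (H z w zS wS (le_trans zw delta1)) _.
by apply: Hd => //; exact: enorm_ge0.
Qed.

Let ReB (x y : R[i]) : complex.Re (x - y) = complex.Re x - complex.Re y.
Proof. by case: x y => [? ?] [? ?]. Qed.

Let ImB (x y : R[i]) : complex.Im (x - y) = complex.Im x - complex.Im y.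
Proof. by case: x y => [? ?] [? ?]. Qed.

Let ctame_P i j : ctame (fun z => P z i j).
Proof.
have near_P z eta : sphere d z -> 0 < eta -> exists2 delta, 0 < delta &
    forall w, sphere d w -> enorm (z - w) <= delta ->
    Normc.normc (P z i j - P w i j) <= eta.
  move=> zS eta0; have [delta /andP[delta0 _] H] := P_continuous zS eta0.
  exists delta => // w wS /(H w wS); apply: le_trans.
  by have := ler_normc_hsnorm (P z - P w) i j; rewrite !mxE.
split; split.
- move=> z zS eta eta0; have [delta delta0 H] := near_P z eta zS eta0.
  by exists delta => // w wS /(H w wS); rewrite -ReB;
    apply: le_trans (ler_Re_normc _).
- by exists 1 => z _; apply: le_trans (ler_Re_normc _) (normc_orthproj _ _ _).
- move=> z zS eta eta0; have [delta delta0 H] := near_P z eta zS eta0.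
  by exists delta => // w wS /(H w wS); rewrite -ImB;
    apply: le_trans (ler_Im_normc _).
- by exists 1 => z _; apply: le_trans (ler_Im_normc _) (normc_orthproj _ _ _).
Qed.

Let ctame_Q i j : ctame (fun z => Q z i j).
Proof.
have -> : (fun z => Q z i j) = (fun z => (1%:M : 'M[R[i]]_l) i j + -1 * P z i j).
  by apply/funext => z; rewrite /Q !mxE mulN1r.
by apply: ctameD; [exact: ctame_cst|exact/ctameZ/ctame_P].
Qed.

Let dist_pair (z w : 'rV[R]_d) (u v : 'rV[R[i]]_l) :
  Num.sqrt (enorm (z - w) ^+ 2 + hsnorm (u - v) ^+ 2) <=
  enorm (z - w) + hsnorm (u - v).
Proof.
have a0 := enorm_ge0 (z - w); have b0 := hsnorm_ge0 (u - v).
rewrite -[leRHS]ger0_norm ?addr_ge0// -sqrtr_sqr; apply: ler_wsqrtr.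
by rewrite sqrrD lerD2r lerDl mulrn_wge0// mulr_ge0.
Qed.

Let row_P_mem z j : row j (P z) \in Omega z.
Proof. by rewrite rowE; exact: memv_orthproj. Qed.

(** Row [j] of [P z] is a vector of [Omega z] of norm at most 1 that varies continuously with [z];
    paired with [z] it stays in the set on which [B] is Hölder continuous. *)
Let ctame_symbol j : ctame (fun z => symbol B z j).
Proof.
have [alpha [C [alpha0 H]]] := B_holder.
have near_b z eta : sphere d z -> 0 < eta -> exists2 delta, 0 < delta &
    forall w, sphere d w -> enorm (z - w) <= delta ->
    Normc.normc (symbol B z j - symbol B w j) <= eta.
  move=> zS eta0.
  have [e1 /andP[e10 e11] H1] := holder_small C alpha0 eta0.
  have e2 : 0 < e1 / 2 by rewrite divr_gt0.
  have [delta /andP[delta0 _] H2] := P_continuous zS e2.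
  exists (Num.min delta (e1 / 2)); first by rewrite lt_min delta0.
  move=> w wS; rewrite le_min => /andP[/(H2 w wS) h1 h2].
  pose t := Num.sqrt (enorm (z - w) ^+ 2 + hsnorm (row j (P z) - row j (P w)) ^+ 2).
  have te : t <= e1.
    apply: le_trans (dist_pair _ _ _ _) _.
    have := hsnorm_row_le (P z - P w) j; rewrite raddfB/=; lra.
  apply: le_trans (H (z, row j (P z)) (w, row j (P w)) _ _ (le_trans te e11)) _.
  - by split => //=; exact: hsnorm_row_orthproj.
  - by split => //=; exact: hsnorm_row_orthproj.
  by apply: H1 => //; exact: sqrtr_ge0.
(* The Hölder condition compares two vectors over the same [z], one of them 0; their distance is at
   most 1, so it yields a bound of the functional itself. *)
have bound z : sphere d z -> Normc.normc (symbol B z j) <= `|C|.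
  move=> zS.
  have h1 := hsnorm_row_orthproj (Omega z) j.
  have h0 : hsnorm (0 : 'rV[R[i]]_l) = 0.
    rewrite /hsnorm big1 ?sqrtr0// => i _; rewrite big1// => k _.
    by rewrite mxE Normc.normc0 expr0n.
  have e0 : enorm (0 : 'rV[R]_d) = 0 by apply/eqP; rewrite enorm_eq0.
  have f0 : fun_of_family B z 0 = 0 by rewrite /fun_of_family !linear0.
  have A1 : [/\ sphere d z, row j (P z) \in Omega z & hsnorm (row j (P z)) <= 1].
    by split.
  have A2 : [/\ sphere d z, (0 : 'rV[R[i]]_l) \in Omega z & hsnorm (0 :
    'rV[R[i]]_l) <= 1].
    by split => //; [exact: mem0v|rewrite h0].
  have := H (z, row j (P z)) (z, 0) A1 A2.
  rewrite /= !subrr subr0 e0 expr0n add0r sqrtr_sqr ger0_norm ?hsnorm_ge0//.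
  rewrite f0 subr0 => /(_ h1)/le_trans; apply.
  rewrite (le_trans (ler_norm _))// normrM ler_piMr// ger0_norm ?powR_ge0//.
  have -> : 1 = 1 `^ alpha :> R by rewrite powR1.
  apply: ge0_ler_powR => //; first exact: ltW.
    by rewrite nnegrE hsnorm_ge0.
  by rewrite nnegrE.
split; split.
- move=> z zS eta eta0; have [delta delta0 H1] := near_b z eta zS eta0.
  by exists delta => // w wS /(H1 w wS); rewrite -ReB;
    apply: le_trans (ler_Re_normc _).
- by exists `|C| => z /bound; apply: le_trans; exact: ler_Re_normc.
- move=> z zS eta eta0; have [delta delta0 H1] := near_b z eta zS eta0.
  by exists delta => // w wS /(H1 w wS); rewrite -ImB;
    apply: le_trans (ler_Im_normc _).
- by exists `|C| => z /bound; apply: le_trans; exact: ler_Im_normc.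
Qed.

Let M : 'M[R[i]]_l := \matrix_(j, k) cmean (fun z => Q z j k).
Let a : 'cV[R[i]]_l := \col_j cmean (fun z => symbol B z j).

(* [v M v^*] is the mean of [|v (1 - pi_(Omega z))|^2]. *)
Let ker_M v : v *m M = 0 -> forall z, sphere d z -> v \in Omega z.
Proof.
move=> vM.
pose F (p : 'I_l * 'I_l) (z : 'rV[R]_d) := (v 0 p.1 * (v 0 p.2)^*) * Q z p.1 p.2.
have tF p : ctame (F p) by exact: ctameZ.
have [tS mS] := ctame_cmean_sum (index_enum _) tF.
have FE z : \sum_p F p z = (hsnorm (v *m Q z) ^+ 2)%:C%C.
  rewrite -mulmx_compl_orthproj -/(P z) -/(Q z) mxE.
  rewrite (eq_bigr (fun k => \sum_j F (j, k) z)).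
    by rewrite exchange_big pair_bigA.
  move=> k _; rewrite !mxE mulr_suml; apply: eq_bigr => j _.
  by rewrite /F/=; ring.
have : cmean (fun z => \sum_p F p z) = 0.
  rewrite mS -(pair_bigA _ (fun j k => cmean (F (j, k)))) exchange_big/=.
  rewrite big1// => k _.
  have : (v *m M) 0 k * (v 0 k)^* = 0 by rewrite vM mxE mul0r.
  rewrite mxE mulr_suml => E; rewrite -[RHS]E; apply: eq_bigr => j _.
  by rewrite /F cmeanZ//= mxE; ring.
move=> /(congr1 (@complex.Re R))/= m0 z zS.
have [tRe _] := tS.
have tN : tame (fun z => hsnorm (v *m Q z) ^+ 2).
  by apply: eq_tame tRe => y; rewrite FE.
have N0 : ball_mean (fun z => hsnorm (v *m Q z) ^+ 2) = 0.
  by rewrite -m0; congr ball_mean; apply/funext => y; rewrite FE.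
(* A continuous nonnegative function of mean 0 vanishes at every point of the sphere, so [v] lies in
   every [Omega z], not merely in almost every one. *)
have := ball_mean_eq0 d_gt0 tN (fun _ _ => sqr_ge0 _) N0 zS.
move=> /eqP; rewrite sqrf_eq0 => /eqP hs0.
apply/memv_orthprojP; apply/eqP; rewrite eq_sym -subr_eq0; apply/eqP.
rewrite -{1}[v]mulmx1 -mulmxBr -/(P z) -/(Q z).
apply/rowP => j; rewrite [RHS]mxE; apply: Normc.eq0_normc.
by apply/eqP; rewrite eq_le normc_ge0 andbT -hs0 ler_normc_hsnorm.
Qed.

(** By [ker_M] the vector [v] lies in all [Omega z], so weak cancellation applies to it; [v *m a] is
    the mean of [B z v], that is, its sphere integral divided by [d]. *)
Let v_a (v : 'rV[R[i]]_l) : v *m M = 0 -> v *m a = 0.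
Proof.
move=> vM; have vO := ker_M vM.
have tF j : ctame (fun z => v 0 j * symbol B z j) by exact: ctameZ.
have [tS mS] := ctame_cmean_sum (index_enum _) tF.
apply/rowP => i; rewrite !mxE ord1.
have -> : \sum_j v 0 j * a j 0 = cmean (fun z => \sum_j v 0 j * symbol B z j).
  by rewrite mS; apply: eq_bigr => j _; rewrite cmeanZ// mxE.
have := B_canceling vO => /eqP; rewrite eq_complex /= => /andP[/eqP r0 /eqP i0].
have dn : d%:R != 0 :> R by rewrite pnatr_eq0 -lt0n.
have [tRe tIm] := tS.
have mRe := Rintegral_surface d_gt0 tRe; have mIm := Rintegral_surface d_gt0 tIm.
apply/eqP; rewrite eq_complex/=; apply/andP; split; apply/eqP.
  apply: (mulfI dn); rewrite -mRe mulr0 -[RHS]r0; apply: eq_Rintegral => z.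
  by rewrite inE => zS; rewrite (fun_of_familyE B (vO z zS)).
apply: (mulfI dn); rewrite -mIm mulr0 -[RHS]i0; apply: eq_Rintegral => z.
by rewrite inE => zS; rewrite (fun_of_familyE B (vO z zS)).
Qed.

(* Only the restriction of [B z] to [Omega z] matters, so that a term
   [(1 - pi_(Omega z)) w] may be subtracted; [w] is chosen to kill the mean. *)
Lemma mean_zero_symbol : exists m : 'I_l -> 'rV[R]_d -> R[i],
  [/\ forall j, ctame (m j), forall j, cmean (m j) = 0 &
      forall z (v : 'rV[R[i]]_l), v \in Omega z ->
        fun_of_family B z v = \sum_j v 0 j * m j z].
Proof.
have [w aw] := exists_mulmx_of_ker v_a.
pose c j z := \sum_k w k 0 * Q z j k.
have tc j := ctame_cmean_sum (index_enum _) (fun k => ctameZ (w k 0) (ctame_Q j k)).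
exists (fun j z => symbol B z j + -1 * c j z).
split.
- by move=> j; apply: ctameD => //; apply: ctameZ; have [] := tc j.
- move=> j; have [t1 t2] := tc j.
  rewrite cmeanD ?cmeanZ//; last exact: ctameZ.
  rewrite t2 mulN1r; apply/eqP; rewrite subr_eq0; apply/eqP.
  have := congr1 (fun N : 'cV[R[i]]_l => N j 0) aw; rewrite !mxE => ->.
  by apply: eq_bigr => k _; rewrite cmeanZ// mxE mulrC.
move=> z v vO; rewrite fun_of_familyE//.
have vQ : v *m Q z *m w = 0.
  by rewrite /Q mulmxBr mulmx1 /P orthproj_id// subrr mul0mx.
under [RHS]eq_bigr do rewrite mulrDr mulN1r mulrN.
rewrite big_split/= sumrN [X in _ - X](_ : _ = 0) ?subr0//.
transitivity ((v *m Q z *m w) 0 0); last by rewrite vQ mxE.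
transitivity (\sum_j \sum_k v 0 j * (w k 0 * Q z j k)).
  by apply: eq_bigr => j _; rewrite mulr_sumr.
rewrite exchange_big mxE /=; apply: eq_bigr => k _.
rewrite [(v *m Q z) 0 k]mxE mulr_suml.
by apply: eq_bigr => j _; ring.
Qed.

End weakly_canceling_operator.

(** * The truncated operator as a sum of scalar multipliers *)

Section truncated_operator_bound.
Variables (R : realType) (d l : nat).
Local Notation lam := (lebesgue_rV R d).
Variable Omega : 'rV[R]_d -> {vspace 'rV[R[i]]_l}.
Variable B : forall z : 'rV[R]_d, {linear subvs_of (Omega z) -> R[i]}.
Variable m : 'I_l -> 'rV[R]_d -> R[i].
Hypothesis Bm : forall z (v : 'rV[R[i]]_l), v \in Omega z ->
  fun_of_family B z v = \sum_j v 0 j * m j z.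

(** Off the annulus both sides vanish. On it [xi] is nonzero, so membership in [W1] puts
    [fourier g xi] in [Omega (direction xi)], where [Bm] applies. *)
Lemma truncated_integrandE (eps rho : R) (g : 'rV[R]_d -> 'rV[R[i]]_l)
    (x xi : 'rV[R]_d) : 0 < eps -> W1 Omega g ->
  cis (2 * pi * dotr x xi) *
    ((\1_[set y : 'rV[R]_d | eps <= enorm y <= rho] xi)%:C%C *
     ((enorm xi) ^- d)%:C%C * fun_of_family B (direction xi) (fourier g xi)) =
  \sum_j complex_integrand (cextension (m j)) eps rho (fun y => g y 0 j) x xi.
Proof.
move=> e0 [_ gO].
rewrite /complex_integrand -mulr_sumr -mulr_sumr; congr (_ * _).
have [xA|xA] := pselect (annulus eps rho xi); last first.
  by rewrite indicE memNset// !mul0r.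
have xi0 : xi != 0 by rewrite -enorm_gt0; move: xA => /andP[+ _];
  exact: lt_le_trans.
congr (_ * _); rewrite Bm; last exact: gO.
by apply: eq_bigr => j _; rewrite cextensionE// mxE.
Qed.

(** The factor 2 counts the real and the imaginary part, each bounded pointwise by
    [hsnorm (g x)]. *)
Lemma lnorm_component (g : 'rV[R]_d -> 'rV[R[i]]_l) j :
  (forall j, cintegrable lam setT (fun x => g x 0 j)) ->
  ((\int[lam]_y `|complex.Re (g y 0 j)| + \int[lam]_y `|complex.Im (g y 0 j)|)%:E <=
   2%:E * 'N[lam]_1 [(fun x => (hsnorm (g x))%:E)])%E.
Proof.
move=> ig; have [iRe iIm] := ig j.
have mhs : measurable_fun setT (fun x => hsnorm (g x)).
  apply: measurable_hsnorm => i; have [r s] := ig i.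
    by move/integrableP : r => [/measurable_EFinP].
  by move/integrableP : s => [/measurable_EFinP].
have H (f : 'rV[R]_d -> R) : lam.-integrable setT (EFin \o f) ->
    (forall x, `|f x| <= hsnorm (g x)) ->
    ((\int[lam]_y `|f y|)%:E <= 'N[lam]_1 [(fun x => (hsnorm (g x))%:E)])%E.
  move=> fi fg; have ni := integrable_norm fi.
  rewrite /Rintegral fineK; last exact: (integrable_fin_num measurableT ni).
  rewrite Lnorm1; apply: ge0_le_integral => //.
  - by move: ni => /integrableP[].
  - by apply: measurableT_comp => //; exact/measurable_EFinP.
  by move=> x _; rewrite /= lee_fin (le_trans (fg x))// ler_norm.
rewrite EFinD mule_natl mule2n leeD//; apply: H => // x.
  exact: le_trans (ler_Re_normc _) (ler_normc_hsnorm _ _ _).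
exact: le_trans (ler_Im_normc _) (ler_normc_hsnorm _ _ _).
Qed.

End truncated_operator_bound.

Theorem theorem1p2 (R : realType) (d l k : nat)
    (d_gt0 : (0 < d)%N) (l_gt0 : (0 < l)%N) (k_gt0 : (0 < k)%N)
    (k_le_l : (k <= l)%N)
    (Omega : 'rV[R]_d -> {vspace 'rV[R[i]]_l})
    (Omega_grass : forall z, sphere d z -> grassmannian l k (Omega z))
    (Omega_holder : holder_subspaces Omega)
    (B : forall z : 'rV[R]_d, {linear subvs_of (Omega z) -> R[i]})
    (B_holder : holder_family B)
    (B_canceling : weakly_canceling B) :
  exists C : R, forall eps rho : R, 0 < eps -> eps < rho ->
    forall g : 'rV[R]_d -> 'rV[R[i]]_l, W1 Omega g ->
      ('N[lebesgue_rV R d]_+oo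
          [(fun x => (Normc.normc (truncated_operator B eps rho g x))%:E)]
        <= C%:E * 'N[lebesgue_rV R d]_1 [(fun x => (hsnorm (g x))%:E)])%E.
Proof.
have [m [tm m0 Bm]] := mean_zero_symbol d_gt0 Omega_holder B_holder B_canceling.
have /choice[C HC] : forall j, exists C : R, 0 <= C /\
    forall (eps rho : R), 0 < eps -> eps <= rho ->
    forall (g : 'rV[R]_d -> R[i]) (x : 'rV[R]_d), cintegrable (lebesgue_rV R d)
      setT g ->
    let Phi := complex_integrand (cextension (m j)) eps rho g x in
    let N := \int[lebesgue_rV R d]_y `|complex.Re (g y)| +
             \int[lebesgue_rV R d]_y `|complex.Im (g y)| in
    [/\ cintegrable (lebesgue_rV R d) setT Phi,
        `|\int[lebesgue_rV R d]_xi complex.Re (Phi xi)| <= C * N &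
        `|\int[lebesgue_rV R d]_xi complex.Im (Phi xi)| <= C * N].
  by move=> j; have [C C0 HC] := cextension_bounded d_gt0 (tm j) (m0 j); exists C.
(* One factor 2 comes from the real and imaginary parts of the output, the other from those of [g],
   through [lnorm_component]. *)
exists (\sum_j 2 * C j * 2) => eps rho e0 er g gW.
have [ig _] := gW.
have C0 j : 0 <= C j by have [] := HC j.
pose lam := lebesgue_rV R d.
pose N j := \int[lam]_y `|complex.Re (g y 0 j)| + \int[lam]_y `|complex.Im (g y
  0 j)|.
have T_bound x : Normc.normc (truncated_operator B eps rho g x) <= \sum_j 2 * C
  j * N j.
  pose Phi j := complex_integrand (cextension (m j)) eps rho (fun y => g y 0 j) x.
  have HPhi j : [/\ cintegrable lam setT (Phi j),
      `|\int[lam]_xi complex.Re (Phi j xi)| <= C j * N j &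
      `|\int[lam]_xi complex.Im (Phi j xi)| <= C j * N j].
    by have [_ H] := HC j; exact: (H eps rho e0 (ltW er) _ x (ig j)).
  have [_ sRe] := @Rintegral_sum _ _ _ (index_enum 'I_l)
    (fun j xi => complex.Re (Phi j xi)) (fun j => let: And3 (conj h _) _ _ :=
      HPhi j in h).
  have [_ sIm] := @Rintegral_sum _ _ _ (index_enum 'I_l)
    (fun j xi => complex.Im (Phi j xi)) (fun j => let: And3 (conj _ h) _ _ :=
      HPhi j in h).
  have Re_sum xi : complex.Re (\sum_j Phi j xi) = \sum_j complex.Re (Phi j xi).
    by elim/big_ind2 : _ => // u u' v v' <- <-; rewrite ReD.
  have Im_sum xi : complex.Im (\sum_j Phi j xi) = \sum_j complex.Im (Phi j xi).
    by elim/big_ind2 : _ => // u u' v v' <- <-; rewrite ImD.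
  rewrite (le_trans (normc_le _))// /truncated_operator /inverse_fourier
    /cintegral /=.
  have -> : \int[lam]_xi complex.Re (cis (2 * pi * dotr x xi) *
      ((\1_[set y : 'rV[R]_d | eps <= enorm y <= rho] xi)%:C%C *
       ((enorm xi) ^- d)%:C%C * fun_of_family B (direction xi) (fourier g xi))) =
      \sum_j \int[lam]_xi complex.Re (Phi j xi).
    by rewrite -sRe; apply: eq_Rintegral => xi _;
      rewrite (truncated_integrandE Bm)// Re_sum.
  have -> : \int[lam]_xi complex.Im (cis (2 * pi * dotr x xi) *
      ((\1_[set y : 'rV[R]_d | eps <= enorm y <= rho] xi)%:C%C *
       ((enorm xi) ^- d)%:C%C * fun_of_family B (direction xi) (fourier g xi))) =
      \sum_j \int[lam]_xi complex.Im (Phi j xi).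
    by rewrite -sIm; apply: eq_Rintegral => xi _;
      rewrite (truncated_integrandE Bm)// Im_sum.
  apply: (@le_trans _ _ (\sum_j C j * N j + \sum_j C j * N j)).
    by apply: lerD; apply: le_trans (ler_norm_sum _ _ _) _; apply: ler_sum => j _;
      have [] := HPhi j.
  rewrite -big_split/=; apply: ler_sum => j _.
  by rewrite le_eqVlt; apply/orP; left; apply/eqP; ring.
set L1 := ('N[_]_1[_])%E.
have L1_ge0 : (0 <= L1)%E by exact: Lnorm_ge0.
have S_le : ((\sum_j 2 * C j * N j)%:E <= (\sum_j 2 * C j * 2)%:E * L1)%E.
  rewrite -!sumEFin ge0_sume_distrl => [|j _]; last by rewrite lee_fin !mulr_ge0.
  apply: lee_sum => j _; rewrite EFinM [X in (_ <= X * _)%E]EFinM -[leRHS]muleA.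
  by rewrite lee_wpmul2l ?lee_fin ?mulr_ge0//; exact: lnorm_component.
(* The norm of exponent [+oo] is an essential supremum when the whole space has positive measure and
   0 otherwise; the bound [T_bound] holds at every point. *)
rewrite unlock /Lnorm; case: ifPn => _; last first.
  by rewrite mule_ge0// lee_fin sumr_ge0// => j _; rewrite !mulr_ge0.
apply/ess_supP; apply: nearW => x /=.
rewrite ger0_norm ?normc_ge0//; apply: le_trans S_le.
by rewrite lee_fin; exact: T_bound.
Qed.
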